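(* Let $\mathcal{M}=M_2(\mathbb{C})$ be the normed algebra of complex $2\times2$ matrices and, for $\alpha,\beta\in\mathbb{C}$, let $$X(\alpha)=\begin{pmatrix}-\alpha&0\\0&-2\alpha\end{pmatrix},\qquad Y(\beta)=\begin{pmatrix}0&\beta(\beta-2\pi i)\\0&0\end{pmatrix}.$$ Then the BCH series $Z(\alpha,\beta):=\sum_{n=1}^\infty Z_n(X(\alpha),Y(\beta))$ converges in $\mathcal{M}$ if and only if $(\alpha,\beta)$ belongs to $$D=\{(\alpha,\beta)\in\mathbb{C}^2:\ |\alpha|<2\pi,\ \beta\notin\{0,2\pi i\}\}\cup(\mathbb{C}\times\{0,2\pi i\}),$$ and its sum is $$Z(\alpha,\beta)=\begin{pmatrix}-\alpha&\frac{\alpha\beta(\beta-2\pi i)}{1-e^{-\alpha}}\\0&-2\alpha\end{pmatrix}\ \text{ if } |\alpha|<2\pi,\ \beta\notin\{0,2\pi i\};\qquad Z(\alpha,\beta)=\begin{pmatrix}-\alpha&0\\0&-2\alpha\end{pmatrix}\ \text{ if } \alpha\in\mathbb{C},\ \beta\in\{0,2\pi i\}.$$ The interior of $D$ is $\mathrm{Int}(D)=\{(\alpha,\beta)\in\mathbb{C}^2:|\alpha|<2\pi\}$, and $(\alpha,\beta)\mapsto Z(\alpha,\beta)$ is analytic on $\mathrm{Int}(D)$. Moreover, the restriction of $Z$ to $\mathrm{Int}(D)$ is prolonged by the $\mathcal{M}$-valued map $$P(\alpha,\beta)=\begin{pmatrix}-\alpha&\frac{\alpha\beta(\beta-2\pi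 i)}{1-e^{-\alpha}}\\0&-2\alpha\end{pmatrix},$$ which is analytic on the open set $$\Omega=\{(\alpha,\beta)\in\mathbb{C}^2:\ \alpha\neq 2k\pi i \text{ for all } k\in\mathbb{Z}\setminus\{0\}\}\supset\mathrm{Int}(D).$$ The prolongation $P$ is singular at $(2\pi i,2\pi i)$, whereas $(2\pi i,2\pi i)\in D$ and the BCH series $Z(2\pi i,2\pi i)$ converges to $X(2\pi i)$.
   Context: The quotient $\frac{\alpha}{1-e^{-\alpha}}$ is understood to equal $1$ at $\alpha=0$. ''$P$ is singular at $(2\pi i,2\pi i)$'' means that this point (which lies on the boundary of $\Omega$) has no neighbourhood to which $P$ extends analytically. The BCH series of two elements $x,y$ of an associative Banach algebra (with $[x,y]=xy-yx$) is the (homogeneous) series $\sum_{n=1}^\infty Z_n(x,y)$, where $Z_n(x,y)$ is the homogeneous Lie polynomial of degree $n$ $$Z_n(x,y)=\frac1n\sum_{k=1}^n\frac{(-1)^{k+1}}{k}\sum_{\substack{(i_1,j_1),\ldots,(i_k,j_k)\neq(0,0)\\ i_1+j_1+\cdots+i_k+j_k=n}}\frac{(\mathrm{ad}\,x)^{i_1}(\mathrm{ad}\,y)^{j_1}\cdots(\mathrm{ad}\,x)^{i_k}(\mathrm{ad}\,y)^{j_k-1}(y)}{i_1!\,j_1!\cdots i_k!\,j_k!},$$ with $i_r,j_r$ nonnegative integers and $(\mathrm{ad}\,a)(b)=[a,b]$; when $j_k=0$ (so $i_k\ne0$) the summand is understood to end with $(\mathrm{ad}\,x)^{i_k-1}(x)$.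 Equivalently, $Z_n(x,y)$ is the homogeneous component of degree $n$ of $\ln(e^xe^y)$ in the algebra of formal power series over $\mathbb{Q}$ in two non-commuting indeterminates. Convergence means convergence in norm of the partial sums $\sum_{n=1}^N Z_n(x,y)$. *)

(* Defs.v *)
From HB Require Import structures.
From mathcomp Require Import all_boot all_order all_algebra.
From mathcomp Require Import complex.
From mathcomp Require Import all_classical all_reals all_analysis.

Set Implicit Arguments.
Unset Strict Implicit.
Unset Printing Implicit Defensive.

Import Order.TTheory GRing.Theory Num.Theory.
Import numFieldNormedType.Exports.

Local Open Scope classical_set_scope.
Local Open Scope ring_scope.
Local Open Scope complex_scope.

(* MathComp-Analysis attaches the topology of the norm to an abstract
   numFieldType K and to K^o, but not to the concrete type R[i]. The topologies
   and norms of R[i] * R[i] (product) and 'M[R[i]]_2 (maximum of the moduli of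
   the entries) are then inferred. *)
#[non_forgetful_inheritance]
HB.instance Definition _ (R : rcfType) := PseudoPointedMetric.copy R[i] R[i]^o.
#[non_forgetful_inheritance]
HB.instance Definition _ (R : rcfType) := NormedModule.copy R[i] R[i]^o.

Section BCH.
Variables (K : numFieldType) (A : algType K).
Implicit Types (x y a b : A) (s : seq (nat * nat)).

Definition ad a b : A := a * b - b * a.

(* (ad x)^i_1 (ad y)^j_1 ... (ad x)^i_k (ad y)^(j_k - 1) y  if j_k <> 0, ending
   with (ad x)^(i_k - 1) x  if j_k = 0, where s = [:: (i_1, j_1); ...; (i_k, j_k)].
   The value 0 on the empty word is never used. *)
Fixpoint bch_word x y s : A :=
  match s with
  | [::] => 0
  | [:: (i, 0%N)] => iter i.-1 (ad x) x
  | [:: (i, j.+1)] => iter i (ad x) (iter j (ad y) y)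
  | (i, j) :: s' => iter i (ad x) (iter j (ad y) (bch_word x y s'))
  end.

(* Exponents in a word of total degree n are at most n, so the pairs (i_r, j_r)
   range over the finite type 'I_n.+1 * 'I_n.+1. *)
Definition bch_admissible n k (s : k.-tuple ('I_n.+1 * 'I_n.+1)) : bool :=
  all (fun p : 'I_n.+1 * 'I_n.+1 => (p.1 != 0%N :> nat) || (p.2 != 0%N :> nat)) s
  && (\sum_(p <- s) (p.1 + p.2) == n)%N.

Definition bch_term n x y : A :=
  n%:R^-1 *: \sum_(1 <= k < n.+1) ((-1) ^+ k.+1 / k%:R) *:
    \sum_(s : k.-tuple ('I_n.+1 * 'I_n.+1) | bch_admissible s)
      ((\prod_(p <- s) (p.1`! * p.2`!))%N)%:R^-1 *:
        bch_word x y [seq (val p.1, val p.2) | p <- s].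

Definition bch_partial x y (N : nat) : A := \sum_(1 <= n < N.+1) bch_term n x y.

End BCH.

Section Analytic.
Variables (R : realType) (E : normedModType R[i]).
Implicit Types (f : R[i] * R[i] -> E) (p q : R[i] * R[i]) (U : set (R[i] * R[i])).

Definition dbl_term (c : nat -> nat -> E) p q (j k : nat) : E :=
  ((q.1 - p.1) ^+ j * (q.2 - p.2) ^+ k) *: c j k.

(* Near p, f is the sum of an absolutely convergent double power series centred
   at p. A bound for the square partial sums of the norms is a bound for all the
   finite partial sums, and the order of R[i] forces the bound M to be real. *)
Definition analytic_at f p :=
  exists c : nat -> nat -> E, \forall q \near p,
    (exists M : R[i], forall N,
       \sum_(j < N) \sum_(k < N) `|dbl_term c p q j k| <= M) /\
    (\sum_(j < N) \sum_(k < N) dbl_term c p q j k @[N --> \oo] --> f q).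

Definition analytic_on U f := forall p, U p -> analytic_at f p.

Definition extends_analytically_at U f p :=
  exists (V : set (R[i] * R[i])) (g : R[i] * R[i] -> E),
    [/\ open_nbhs p V, analytic_on V g & forall q, V q -> U q -> g q = f q].

Definition singular_at U f p := ~ extends_analytically_at U f p.

End Analytic.

Section Example.
Variable R : realType.
Local Notation C := R[i].
Implicit Types (a b : C) (p : C * C).

Definition cexp (z : C) : C :=
  (expR (complex.Re z))%:C * (cos (complex.Im z) +i* sin (complex.Im z)).

Definition twopi : C := (2 * pi)%:C.
Definition twopii : C := 0 +i* (2 * pi).

Definition mx2 (a11 a12 a21 a22 : C) : 'M[C]_2 :=
  \matrix_(i, j) (if i == 0 then if j == 0 then a11 else a12
                  else if j == 0 then a21 else a22).

Definition X a : 'M[C]_2 := mx2 (- a) 0 0 (- (2 * a)).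
Definition Y b : 'M[C]_2 := mx2 0 (b * (b - twopii)) 0 0.

Definition bch_XY p : nat -> 'M[C]_2 := bch_partial (X p.1) (Y p.2).

(* The limit is only meaningful where the partial sums converge. *)
Definition Z p : 'M[C]_2 := limn (bch_XY p).

Definition todd a : C := if a == 0 then 1 else a / (1 - cexp (- a)).

Definition P p : 'M[C]_2 :=
  mx2 (- p.1) (todd p.1 * (p.2 * (p.2 - twopii))) 0 (- (2 * p.1)).

Definition D : set (C * C) :=
  [set p | `|p.1| < twopi /\ ~ [set 0; twopii] p.2]
  `|` (setT `*` [set 0; twopii]).

Definition Omega : set (C * C) :=
  [set p | forall k : int, k != 0 -> p.1 <> k%:~R * twopii].

End Example.

(* Main.v *)
Require Import Defs.
From HB Require Import structures.
From mathcomp Require Import all_boot all_order all_algebra.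
From mathcomp Require Import complex ring lra zify.
From mathcomp Require Import all_classical all_reals all_analysis.

Set Implicit Arguments.
Unset Strict Implicit.
Unset Printing Implicit Defensive.

Import Order.TTheory GRing.Theory Num.Theory.
Import numFieldNormedType.Exports.
Import ComplexField.Normc.

Local Open Scope classical_set_scope.
Local Open Scope ring_scope.
Local Open Scope complex_scope.

(** Since [X, Y] = a Y, a Dynkin word of degree n > 1 vanishes unless its
    letters are x ... x y or x ... x y x, so Z_n(X, Y) is a multiple of
    a^(n-1) Y; summing the weights of these words as formal power series in
    U = e^t - 1 identifies the multiplier as the coefficient of t^(n-1) in
    tau = t / (1 - e^-t). Everything then reduces to the power series tau.

    Its radius of convergence is found without complex analysis: tau satisfies
    the Riccati equation t tau' = tau - tau^2 + t tau, so the moduli s_n of the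
    coefficients of sigma = tau - 1 - t/2 satisfy
    (n+1) s_n <= [n = 2]/4 + sum_i s_i s_(n-i), and comparison with the solution
    1 - (x/2) cot(x/2) of the corresponding real equation bounds the partial sums
    of sum_n s_n x^n for 0 <= x < 2 pi. Conversely the pole of a / (1 - e^-a) at
    2 pi i prevents the terms tau_n a^n from tending to 0 when |a| >= 2 pi.

    Away from the origin, power series of a / (1 - e^-a) are obtained by
    inverting those of 1 - e^-a. The prolongation is singular at
    (2 pi i, 2 pi i) because it is unbounded near this point, whereas an analytic
    extension would be bounded there. *)

(** * Formal power series *)

(** A wrapper rather than the bare function type, so that the convolution product does not compete
    with pointwise operations on functions. *)
Record fps (K : Type) := Fps { fcoef :> nat -> K }.

HB.instance Definition _ (K : Type) := gen_eqMixin (fps K).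
HB.instance Definition _ (K : Type) := gen_choiceMixin (fps K).

Lemma fpsP (K : Type) (f g : fps K) : (forall n, f n = g n) -> f = g.
Proof. by case: f g => [f] [g] fg; congr Fps; apply/funext. Qed.

Section FpsRing.
Variable K : comNzRingType.
Implicit Types f g h : fps K.

Definition fadd f g := Fps (fun n => f n + g n).
Definition fopp f := Fps (fun n => - f n).
Definition fmul f g := Fps (fun n => \sum_(i < n.+1) f i * g (n - i)%N).
Definition fconst c : fps K := Fps (fun n => if n == 0%N then c else 0).

Let trunc N f : {poly K} := \poly_(i < N) f i.

Let coef_trunc N f n : (n < N)%N -> (trunc N f)`_n = f n.
Proof. by move=> nN; rewrite coef_poly nN. Qed.

(** Coefficients of index below [N] depend only on the truncations at [N]; the ring laws and the
    Leibniz rule are thus inherited from [{poly K}]. *)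
Let coef_truncM N f g n : (n < N)%N -> (trunc N f * trunc N g)`_n = fmul f g n.
Proof.
move=> nN; rewrite coefM; apply: eq_bigr => i _.
by rewrite !coef_trunc // ?(leq_ltn_trans _ nN) ?leq_subr // -ltnS.
Qed.

Let faddA : associative fadd.
Proof. by move=> f g h; apply: fpsP => n /=; rewrite addrA. Qed.
Let faddC : commutative fadd.
Proof. by move=> f g; apply: fpsP => n /=; rewrite addrC. Qed.
Let fadd0 : left_id (fconst 0) fadd.
Proof. by move=> f; apply: fpsP => n /=; rewrite if_same add0r. Qed.
Let faddN : left_inverse (fconst 0) fopp fadd.
Proof. by move=> f; apply: fpsP => n /=; rewrite if_same addNr. Qed.

HB.instance Definition _ :=
  GRing.isZmodule.Build (fps K) faddA faddC fadd0 faddN.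

Let fmulC : commutative fmul.
Proof.
by move=> f g; apply: fpsP => n; rewrite -!(@coef_truncM n.+1) // mulrC.
Qed.
Let fmulA : associative fmul.
Proof.
move=> f g h; apply: fpsP => n /=; rewrite [RHS](eq_bigr (fun i : 'I_n.+1 =>
  (trunc n.+1 f * trunc n.+1 g)`_i * (trunc n.+1 h)`_(n - i))); last first.
  by move=> i _; rewrite coef_truncM // coef_trunc // ltnS leq_subr.
rewrite -coefM -mulrA coefM; apply: eq_bigr => i _.
by rewrite coef_trunc // coef_truncM // ltnS leq_subr.
Qed.
Let fmul1 : left_id (fconst 1) fmul.
Proof.
move=> f; apply: fpsP => n /=; rewrite big_ord_recl /= subn0 mul1r.
by rewrite big1 ?addr0 // => i _; rewrite mul0r.
Qed.
Let fmulDl : left_distributive fmul fadd.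
Proof.
move=> f g h; apply: fpsP => n /=; rewrite -big_split /=.
by apply: eq_bigr => i _; rewrite mulrDl.
Qed.
Let fone_neq0 : fconst 1 != fconst 0.
Proof.
apply/eqP => /(congr1 (fun f : fps K => f 0%N)) /= /eqP.
by rewrite (negPf (oner_neq0 _)).
Qed.

HB.instance Definition _ := GRing.Zmodule_isComNzRing.Build (fps K)
  fmulA fmulC fmul1 fmulDl fone_neq0.

Lemma fcoefD f g n : (f + g) n = f n + g n. Proof. by []. Qed.
Lemma fcoefB f g n : (f - g) n = f n - g n. Proof. by []. Qed.
Lemma fcoefM f g n : (f * g) n = \sum_(i < n.+1) f i * g (n - i)%N.
Proof. by []. Qed.
Lemma fcoef0 n : (0 : fps K) n = 0. Proof. by rewrite /= if_same. Qed.
Lemma fcoef1 n : (1 : fps K) n = (n == 0%N)%:R.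
Proof. by rewrite /=; case: eqP. Qed.
Lemma fcoef_sum (I : Type) (r : seq I) (P : pred I) (F : I -> fps K) n :
  (\sum_(i <- r | P i) F i) n = \sum_(i <- r | P i) F i n.
Proof.
by apply: (big_morph (fun f : fps K => f n)) => [f g|]; rewrite ?fcoef0.
Qed.
Lemma fcoefMn f m n : (f *+ m) n = f n *+ m.
Proof. by elim: m => [|m IH]; rewrite ?mulr0n ?fcoef0 // !mulrS fcoefD IH. Qed.

Lemma fcoefCM c f n : (fconst c * f) n = c * f n.
Proof.
rewrite fcoefM big_ord_recl /= subn0 big1 ?addr0 // => i _.
by rewrite mul0r.
Qed.

Lemma fconst_nat m : fconst m%:R = m%:R.
Proof.
by apply: fpsP => n; rewrite fcoefMn fcoef1 /=; case: eqP; rewrite ?mul0rn.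
Qed.

Lemma fconst1 : fconst 1 = 1. Proof. by []. Qed.

Lemma fconstN c : fconst (- c) = - fconst c.
Proof. by apply: fpsP => -[|n] //=; rewrite oppr0. Qed.

Lemma fconstM c d : fconst c * fconst d = fconst (c * d).
Proof. by apply: fpsP => n; rewrite fcoefCM /=; case: eqP; rewrite ?mulr0. Qed.

Definition ft : fps K := Fps (fun n => (n == 1%N)%:R).

Lemma fcoefTM0 f : (ft * f) 0%N = 0.
Proof. by rewrite fcoefM big_ord1 mul0r. Qed.

Lemma fcoefTMS f n : (ft * f) n.+1 = f n.
Proof.
rewrite fcoefM big_ord_recl /= mul0r add0r big_ord_recl /= mul1r subSS subn0.
by rewrite big1 ?addr0 // => i _; rewrite mul0r.
Qed.

Lemma fps_tI : injective (fun f => ft * f).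
Proof.
by move=> f g fg; apply: fpsP => n; rewrite -(fcoefTMS f) fg fcoefTMS.
Qed.

Definition fderiv f : fps K := Fps (fun n => f n.+1 *+ n.+1).

Lemma fcoef_deriv f n : fderiv f n = n.+1%:R * f n.+1.
Proof. by rewrite mulr_natl. Qed.

Lemma fderivD f g : fderiv (f + g) = fderiv f + fderiv g.
Proof. by apply: fpsP => n; rewrite /= mulrnDl. Qed.

Lemma fderiv_sum (I : Type) (r : seq I) (P : pred I) (F : I -> fps K) :
  fderiv (\sum_(i <- r | P i) F i) = \sum_(i <- r | P i) fderiv (F i).
Proof.
apply: (big_morph fderiv fderivD).
by apply: fpsP => n; rewrite /= if_same mul0rn.
Qed.

Lemma fderivM f g : fderiv (f * g) = fderiv f * g + f * fderiv g.
Proof.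
apply: fpsP => n; transitivity (fmul f g n.+1 *+ n.+1) => //.
rewrite -(@coef_truncM n.+2) // -coef_deriv derivM.
rewrite coefD fcoefD; congr (_ + _); rewrite coefM fcoefM; apply: eq_bigr => i _.
  have le_in : (i <= n)%N by rewrite -ltnS.
  rewrite coef_deriv !coef_trunc ?ltnS //.
  by rewrite (leq_trans (leq_subr _ _)).
have le_in : (i < n.+2)%N by rewrite ltnW // ltnS.
by rewrite coef_deriv !coef_trunc ?ltnS ?leq_subr.
Qed.

Lemma fderivC c : fderiv (fconst c) = 0.
Proof. by apply: fpsP => n; rewrite fcoef0 /= mul0rn. Qed.

Lemma fderivT : fderiv ft = 1.
Proof.
by apply: fpsP => n; rewrite fcoef1 /= eqSS; case: eqP => [->|]; rewrite ?mul0rn.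
Qed.

Lemma fderivX f n : fderiv (f ^+ n) = n%:R * f ^+ n.-1 * fderiv f.
Proof.
elim: n => [|n IH]; first by rewrite expr0 -fconst1 fderivC !mul0r.
rewrite exprS fderivM IH /=; case: n {IH} => [|n]; first by rewrite !expr0; ring.
by rewrite exprS /= -[n.+2%:R]natr1; ring.
Qed.

(** Congruence modulo [t^n]: it lets a partial sum of the logarithm stand for the full series with
    no topology on [fps K]. *)
Definition fagree n f g := forall i, (i < n)%N -> f i = g i.

Lemma fagreeM n f f' g g' :
  fagree n f f' -> fagree n g g' -> fagree n (f * g) (f' * g').
Proof.
move=> ff' gg' i lin; rewrite !fcoefM; apply: eq_bigr => j _.
rewrite ff' ?gg' // ?(leq_ltn_trans _ lin) ?leq_subr //.
by rewrite -ltnS.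
Qed.

Lemma fagree_refl n f : fagree n f f. Proof. by []. Qed.

Lemma fagreeB n f f' g g' :
  fagree n f f' -> fagree n g g' -> fagree n (f - g) (f' - g').
Proof. by move=> ff' gg' i lin; rewrite !fcoefB ff' ?gg'. Qed.

Lemma fcoefTXM m f i : (i < m)%N -> (ft ^+ m * f) i = 0.
Proof.
elim: m i f => [|m IH] [|i] f // im; rewrite exprS -mulrA ?fcoefTM0 // fcoefTMS.
exact: IH.
Qed.

End FpsRing.

Section FpsField.
Variable K : fieldType.
Implicit Types f g : fps K.

(** Each coefficient of the inverse depends on all the previous ones, so the recursion carries the
    whole list of them. *)
Fixpoint finv_seq f n : seq K :=
  if n is m.+1 then
    let s := finv_seq f m in
    rcons s (- (f 0%N)^-1 * \sum_(i < m.+1) f (m.+1 - i)%N * s`_i)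
  else [:: (f 0%N)^-1].

Definition finv f : fps K := Fps (fun n => (finv_seq f n)`_n).

Lemma mulfV_fps f : f 0%N != 0 -> f * finv f = 1.
Proof.
move=> f0.
have sz n : size (finv_seq f n) = n.+1.
  by elim: n => //= n IH; rewrite size_rcons IH.
have nthE n m : (n <= m)%N -> (finv_seq f m)`_n = finv f n.
  elim: m => [|m IH]; first by rewrite leqn0 => /eqP ->.
  rewrite leq_eqVlt => /orP[/eqP -> //|nm]; rewrite /= nth_rcons sz nm.
  exact: IH.
apply: fpsP => n; rewrite mulrC fcoefM fcoef1; case: n => [|n].
  by rewrite big_ord1 /= mulVf.
rewrite big_ord_recr /= subnn nth_rcons sz ltnn eqxx.
rewrite (eq_bigr (fun i : 'I_n.+1 => f (n.+1 - i)%N * (finv_seq f n)`_i)); last first.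
  by move=> i _; rewrite nthE 1?mulrC // -ltnS.
by rewrite mulrAC mulNr mulVf // mulN1r subrr.
Qed.

End FpsField.

(** * Exponential and Todd series *)

Section FpsExp.
Variable K : numFieldType.
Implicit Types f g : fps K.

Let fact1 : 1`! = 1%N. Proof. by []. Qed.

Definition fexp (c : K) : fps K := Fps (fun n => c ^+ n / n`!%:R).

Lemma fderiv_exp c : fderiv (fexp c) = fconst c * fexp c.
Proof.
apply: fpsP => n; rewrite fcoefCM /= exprS factS natrM -[LHS]mulr_natr.
have : n`!%:R != 0 :> K by rewrite pnatr_eq0 -lt0n fact_gt0.
have : n.+1%:R != 0 :> K by rewrite pnatr_eq0.
by move: n.+1%:R n`!%:R => x y x0 y0; field; rewrite x0 y0.
Qed.

(** On coefficients the equation reads [(n+1) f_(n+1) = c f_n], which determines [f] in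
    characteristic 0. *)
Lemma fps_ode_unique c f : f 0%N = 1 -> fderiv f = fconst c * f -> f = fexp c.
Proof.
move=> f0 Df; apply: fpsP; elim=> [|n IH].
  by rewrite f0 /= expr0 fact0 divr1.
have n0 : n.+1%:R != 0 :> K by rewrite pnatr_eq0.
apply: (mulfI n0); rewrite -!fcoef_deriv Df fderiv_exp.
by rewrite !fcoefCM IH.
Qed.

Lemma fexpD c d : fexp c * fexp d = fexp (c + d).
Proof.
apply: fps_ode_unique.
  by rewrite fcoefM big_ord1 /= !expr0 fact0 divr1 mulr1.
rewrite fderivM !fderiv_exp.
have -> : fconst (c + d) = fconst c + fconst d.
  by apply: fpsP => n /=; case: eqP; rewrite ?addr0.
ring.
Qed.

Lemma fexp0 : fexp 0 = 1.
Proof.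
by apply: fpsP => -[|n] /=; rewrite ?expr0 ?fact0 ?divr1 // expr0n mul0r.
Qed.

(* [fexpm1_div c] is (e^(ct) - 1)/(ct) *)
Definition fexpm1_div (c : K) : fps K := Fps (fun n => c ^+ n / n.+1`!%:R).

Lemma fexpm1_divE c : ft K * fconst c * fexpm1_div c = fexp c - 1.
Proof.
rewrite -mulrA; apply: fpsP => -[|n]; rewrite fcoefB fcoef1.
  by rewrite fcoefTM0 /= expr0 fact0 divr1 subrr.
by rewrite fcoefTMS fcoefCM subr0 /= exprS mulrA.
Qed.

(** The series of [t / (1 - e^-t)]: the inverted series is [(e^-t - 1) / (-t)], with constant term
    1. *)
Definition todd_fps : fps K := finv (fexpm1_div (-1)).

Local Notation T := (ft K).
Local Notation E := (fexp 1).
Local Notation U := (E - 1).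
Local Notation V := (fexpm1_div 1).
Local Notation W := (finv V).
Local Notation tau := todd_fps.

Lemma todd_fpsP : fexpm1_div (-1) * tau = 1.
Proof. by apply: mulfV_fps; rewrite /= expr0 fact1 divr1 oner_neq0. Qed.

Let V0 : V 0%N != 0. Proof. by rewrite /= expr0 fact1 divr1 oner_neq0. Qed.
Let VW : V * W = 1. Proof. exact: (mulfV_fps V0). Qed.
Let TV : T * V = U.
Proof. by rewrite -fexpm1_divE fconst1 mulr1. Qed.

Let tauE : tau = W * E.
Proof.
have EVm : E * fexpm1_div (-1) = V.
  apply: (@fps_tI K); rewrite /= TV.
  have := fexpm1_divE (-1); rewrite fconstN fconst1 mulrN1 mulNr => /eqP.
  rewrite eqr_oppLR opprB => /eqP TVm.
  by rewrite mulrCA TVm mulrBr mulr1 fexpD subrr fexp0.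
rewrite -[LHS]mul1r -VW -EVm -[RHS]mulr1 -todd_fpsP; ring.
Qed.

(** Differentiating [t V = e^t - 1] gives [t V' = e^t - V]; differentiating [V W = 1] transfers this
    to [W = t / (e^t - 1)]. *)
Let TDW : T * fderiv W = W - W ^+ 2 * E.
Proof.
have DU : fderiv U = E.
  by rewrite fderivD fderiv_exp mul1r -fconst1 -fconstN fderivC addr0.
have TDV : T * fderiv V = E - V.
  have <- : fderiv (T * V) = E by rewrite TV DU.
  by rewrite fderivM fderivT mul1r [RHS]addrAC subrr add0r.
have DVW : fderiv V * W + V * fderiv W = 0.
  by rewrite -fderivM VW -fconst1 fderivC.
have : T * fderiv W = (V * W) * (T * fderiv W) by rewrite VW mul1r.
rewrite (_ : V * W * _ = W * T * (V * fderiv W)); last by ring.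
move/eqP: DVW; rewrite addrC addr_eq0 => /eqP -> ->.
rewrite (_ : W * T * _ = - (W ^+ 2 * (T * fderiv V))); last by ring.
rewrite TDV (_ : - _ = W * (V * W) - W ^+ 2 * E); last by ring.
by rewrite VW mulr1.
Qed.


Let TW : T * W = (E - 1) * W ^+ 2.
Proof. by rewrite -TV -[LHS]mulr1 -VW; ring. Qed.

Let TDtau : T * fderiv tau = tau - W ^+ 2 * E ^+ 2 + T * tau.
Proof.
rewrite tauE fderivM fderiv_exp mul1r mulrDr mulrA TDW.
by rewrite (_ : E ^+2 = E * E) //; ring.
Qed.

Lemma todd_riccati : T * fderiv tau = tau - tau ^+ 2 + T * tau.
Proof. by rewrite TDtau tauE; ring. Qed.

Let DTtau : fderiv (T * tau) = 2%:R * W * E - W ^+ 2 * E.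
Proof.
rewrite fderivM fderivT TDtau.
have -> : T * tau = T * W * E by rewrite tauE mulrA.
by rewrite TW tauE; ring.
Qed.

Let c k : K := (-1) ^+ k.+1 / k%:R.
(** [L n] and [M n] truncate [ln(1 + U) / U] and [(ln(1 + U) - U) / U^2]; since [ln(1 + U) = t], the
    first approximates [W]. *)
Let L n := \sum_(1 <= k < n.+1) fconst (c k) * U ^+ k.-1.
Let M n := \sum_(2 <= k < n.+1) fconst (c k) * U ^+ k.-2.

(** [t V L n] is the truncated series of [ln(1 + U)]; its derivative is a geometric sum equal to
    [1 - (-U)^n], and [U^n] is divisible by [t^n]. *)
Let fagree_VL n : fagree n (V * L n) 1.
Proof.
have DUL : fderiv (T * (V * L n)) = 1 - (- U) ^+ n.
  rewrite mulrA TV /L big_distrr fderiv_sum /=.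
  transitivity (\sum_(0 <= k < n) E * (- U) ^+ k).
    rewrite big_add1; apply: eq_big_nat => k _ /=.
    rewrite mulrCA -exprS fderivM fderivC mul0r add0r fderivX /=.
    rewrite fderivD fderiv_exp mul1r.
    rewrite -fconst1 -fconstN fderivC addr0 mulrA [fconst _ * _]mulrA -fconst_nat fconstM.
    have -> : c k.+1 * k.+1%:R = (-1) ^+ k.
      by rewrite /c -mulrA mulVf ?pnatr_eq0 // mulr1 !exprS mulrA mulrNN !mul1r.
    rewrite mulrC; congr (_ * _); rewrite [in RHS]exprNn; congr (_ * _).
    rewrite -signr_odd -[in RHS]signr_odd; case: (odd k) => //=.
    by apply: fpsP => -[|m] /=; rewrite ?expr1 //= ?oppr0.
  rewrite -big_distrr big_mkord /= -[RHS]opprB subrX1 -mulNr.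
  by congr (_ * _); ring.
move=> i lin; have := congr1 (fun f : fps K => f i) DUL.
rewrite fcoef_deriv fcoefTMS fcoefB -TV -mulrN exprMn fcoefTXM // subr0 fcoef1.
case: i {lin} => [|j]; first by rewrite mul1r.
by move/eqP; rewrite mulf_eq0 pnatr_eq0 /= => /eqP.
Qed.

Let fagree_L n : fagree n (L n) W.
Proof.
have := fagreeM (@fagree_refl K n W) (@fagree_VL n).
by rewrite mulr1 mulrA (mulrC W) VW mul1r.
Qed.

Let TME n : (0 < n)%N -> T * M n = W * (L n - 1).
Proof.
case: n => // n _.
have -> : L n.+1 = 1 + T * V * M n.+1.
  rewrite /L /M TV big_ltn // expr0 mulr1.
  rewrite (_ : c 1 = 1) ?divr1 ?sqrr_sign //; last by rewrite /c divr1 expr2 mulrNN mulr1.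
  congr (_ + _); rewrite big_distrr; apply: eq_big_nat => -[|[|k]] //= _.
  by rewrite mulrCA exprS.
rewrite -[LHS]mul1r -VW; ring.
Qed.

(* The k-th summand of Dynkin's formula is the coefficient of
   T e^T U^(k-1) - [2 <= k] T^2 e^T U^(k-2), with U = e^T - 1. *)
Lemma todd_fps_dynkin n :
  \sum_(1 <= k < n.+2) c k *
     (T * (E * U ^+ k.-1) - (1 < k)%:R * T * (T * (E * U ^+ k.-2))) n.+1
  = n.+1%:R * tau n.
Proof.
have -> : n.+1%:R * tau n = fderiv (T * tau) n.
  by rewrite fcoef_deriv fcoefTMS.
rewrite DTtau.
have -> : 2%:R * W * E - W ^+ 2 * E = E * W - E * (W * (W - 1)) by ring.
(* Modulo [t^(n+1)], [L n.+1] is [W] and [T * M n.+1] is [W (W - 1)]. *)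
transitivity ((E * L n.+1 - E * (T * M n.+1)) n); last first.
  rewrite TME //; apply: (@fagreeB _ n.+1) => //.
    by apply: fagreeM => //; exact: fagree_L.
  apply: fagreeM => //; apply: fagreeM => //; apply: fagreeB => //.
transitivity ((T * (E * L n.+1 - E * (T * M n.+1))) n.+1); last by rewrite fcoefTMS.
rewrite mulrBr (_ : E * (T * _) = T * E * M n.+1); last by ring.
rewrite /L /M [X in _ - T * (_ * X)](_ : _ =
   \sum_(1 <= k < n.+2) (1 < k)%:R * (fconst (c k) * U ^+ k.-2)); last first.
  rewrite [RHS]big_ltn //= mul0r add0r; apply: eq_big_nat => k /andP[k1 _].
  by rewrite k1 mul1r.
rewrite !mulr_sumr fcoefB !fcoef_sum -sumrB; apply: eq_bigr => k _.
by rewrite -fcoefCM -fcoefB; congr (fcoef _ _); ring.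
Qed.

(* With tau = 1 + t/2 + sigma, the linear terms of the Riccati equation cancel
   up to t^2/4. *)
Lemma todd_riccati_coef n (sigma := tau - 1 - fconst 2^-1 * T) :
  n.+1%:R * sigma n = (n == 2)%:R / 4%:R - (sigma ^+ 2) n.
Proof.
have h2 : fconst 2^-1 + fconst 2^-1 = 1 :> fps K.
  apply: fpsP => -[|m] /=; last by rewrite addr0.
  by field.
have : T * fderiv sigma + sigma = fconst 4%:R^-1 * T ^+ 2 - sigma ^+ 2.
  have h4 : fconst 4%:R^-1 = fconst 2^-1 ^+ 2 :> fps K.
    by rewrite expr2 fconstM -invfM -natrM.
  have Ds : fderiv sigma = fderiv tau - fconst 2^-1.
    rewrite /sigma -fconst1 -mulNr -!fconstN.
    by rewrite !fderivD fderivM !fderivC fderivT mul0r mulr1 add0r addr0.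
  rewrite Ds mulrBr todd_riccati h4.
  have -> : tau = 1 + fconst 2^-1 * T + sigma by rewrite /sigma; ring.
  have e : 1 = fconst 2^-1 + fconst 2^-1 :> fps K by rewrite h2.
  set x := fconst 2^-1 in h2 e *; clearbody x sigma.
  apply/eqP; rewrite -subr_eq0; apply/eqP.
  (* With [x = 1/2] treated as an indeterminate, the two sides differ by a multiple of [1 - 2x],
     which is zero. *)
  transitivity ((1 - x - x) * (T + x * T ^+ 2 + sigma * T)); first by ring.
  by rewrite -addrA -opprD h2 subrr mul0r.
clearbody sigma => /(congr1 (fun f : fps K => f n)).
rewrite fcoefD fcoefB fcoefCM.
have -> : (T ^+ 2) n = (n == 2)%:R.
  by rewrite expr2; case: n => [|n]; rewrite ?fcoefTM0 ?fcoefTMS.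
rewrite [_ / _]mulrC => <-; case: n => [|n].
  by rewrite fcoefTM0 mul1r add0r.
by rewrite fcoefTMS fcoef_deriv -[n.+2%:R]natr1 mulrDl mul1r.
Qed.

Lemma todd_fps0 : tau 0%N = 1.
Proof.
have := congr1 (fun f : fps K => f 0%N) todd_fpsP.
by rewrite fcoefM fcoef1 big_ord1 /= expr0 fact1 divr1 mul1r.
Qed.

End FpsExp.

(** * Dynkin's formula when [x, y] is a multiple of y *)

Lemma big_tuple_cons (V : nmodType) (I : finType) k (P : pred (k.+1.-tuple I))
    (F : k.+1.-tuple I -> V) :
  \sum_(s | P s) F s =
  \sum_p \sum_(s : k.-tuple I | P [tuple of p :: s]) F [tuple of p :: s].
Proof.
rewrite pair_big_dep /=.
rewrite (reindex (fun u : I * k.-tuple I => [tuple of u.1 :: u.2])) //=.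
exists (fun s => (thead s, [tuple of behead s])) => [[p s] _ | s _] /=.
  by congr pair; apply: val_inj.
by rewrite -tuple_eta.
Qed.

Lemma big_tuple1 (V : nmodType) (I : finType) (P : pred (1.-tuple I))
    (F : 1.-tuple I -> V) :
  \sum_(s | P s) F s = \sum_(p | P [tuple p]) F [tuple p].
Proof.
rewrite big_tuple_cons [RHS]big_mkcond; apply: eq_bigr => p _.
rewrite big_mkcond (big_pred1 [tuple]) => [|s]; last by apply/esym/eqP; exact: tuple0.
by rewrite (_ : [tuple of p :: _] = [tuple p]) //; apply: val_inj.
Qed.

Lemma sum_delta (V : nmodType) n c (F : nat -> V) :
  \sum_(i < n) (if i == c :> nat then F i else 0) = if (c < n)%N then F c else 0.
Proof.
rewrite -big_mkcond; case: ifP => cn; last first.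
  by rewrite big1 // => i /eqP ic; rewrite -ic ltn_ord in cn.
by rewrite (big_pred1 (Ordinal cn)).
Qed.

Section Dynkin.
Variables (K : numFieldType) (A : algType K) (x y : A) (a : K).
Hypothesis adxy : ad x y = a *: y.

Implicit Types (b u v : A) (c : K) (i j d : nat).

Let op i j v := iter i (ad x) (iter j (ad y) v).

Let adD b u v : ad b (u + v) = ad b u + ad b v.
Proof. by rewrite /ad mulrDl mulrDr opprD addrACA. Qed.
Let adZ b c v : ad b (c *: v) = c *: ad b v.
Proof. by rewrite /ad -scalerAl -scalerAr scalerBr. Qed.
Let iadD b i u v : iter i (ad b) (u + v) = iter i (ad b) u + iter i (ad b) v.
Proof. by elim: i => //= i ->; rewrite adD. Qed.
Let iadZ b i c v : iter i (ad b) (c *: v) = c *: iter i (ad b) v.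
Proof. by elim: i => //= i ->; rewrite adZ. Qed.
Let opD i j u v : op i j (u + v) = op i j u + op i j v.
Proof. by rewrite /op !iadD. Qed.
Let opZ i j c v : op i j (c *: v) = c *: op i j v.
Proof. by rewrite /op !iadZ. Qed.
Let op0 i j : op i j 0 = 0.
Proof. by rewrite -[X in op _ _ X](scale0r (0 : A)) opZ scale0r. Qed.

Let adyx : ad y x = - a *: y.
Proof. by rewrite scaleNr -adxy /ad opprB. Qed.
Let ad_id b : ad b b = 0. Proof. by rewrite /ad subrr. Qed.
Let iad0 b i : iter i (ad b) 0 = 0.
Proof. by elim: i => //= i ->; rewrite /ad mul0r mulr0 subrr. Qed.
Let iadxy i : iter i (ad x) y = a ^+ i *: y.
Proof.
by elim: i => [|i IH] /=; rewrite ?scale1r // IH adZ adxy scalerA exprSr.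
Qed.

Let opy i j : op i j y = if j == 0%N then a ^+ i *: y else 0.
Proof.
rewrite /op; case: j => [|j] /=; first exact: iadxy.
by rewrite -iterS iterSr ad_id !iad0.
Qed.

(** One [ad y] turns [x] into a multiple of the eigenvector [y], which a second one kills; with no
    [ad y], the innermost [ad x] kills [x]. *)
Let opx i j : (i != 0)%N || (j != 0)%N ->
  op i j x = if j == 1%N then - a ^+ i.+1 *: y else 0.
Proof.
rewrite /op; case: j => [|[|j]] /=.
- by case: i => // i _; rewrite iterSr ad_id !iad0.
- by move=> _; rewrite adyx iadZ iadxy scalerA mulNr exprS.
- move=> _; rewrite -!iterS [iter j.+2 _ _]iterSr adyx iadZ iterSr ad_id iad0.
  by rewrite scaler0 iad0.
Qed.

Let word_cons i j s : s != [::] ->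
  bch_word x y ((i, j) :: s) = op i j (bch_word x y s).
Proof. by case: s => // p s _; case: j. Qed.

Let word1 i j : (i != 0)%N || (j != 0)%N -> bch_word x y [:: (i, j)] =
  if j == 1%N then a ^+ i *: y else if (i, j) == (1, 0)%N then x else 0.
Proof.
case: j => [|[|j]] /= => [|_|_].
- case: i => [|[|i]] // _; rewrite -pred_Sn /=.
  by rewrite -iterS iterSr ad_id iad0.
- exact: iadxy.
- by rewrite xpair_eqE andbF -iterS iterSr ad_id !iad0.
Qed.

Section Bound.
Variable m : nat.
Local Notation I := ('I_m.+1 * 'I_m.+1)%type.

Let nz (p : I) := (p.1 != 0%N :> nat) || (p.2 != 0%N :> nat).
Let adm d (s : seq I) := all nz s && (\sum_(p <- s) (p.1 + p.2) == d)%N.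
Let wt (s : seq I) : K := ((\prod_(p <- s) (p.1`! * p.2`!))%N)%:R^-1.
(** The exponent bound [m] is independent of the degree [d], because removing a pair from a word
    lowers [d] but must not change the index type. *)
Let S k d := \sum_(s : k.-tuple I | adm d s)
  wt s *: bch_word x y [seq (val p.1, val p.2) | p <- s].

Let wt_cons p s : wt (p :: s) = (p.1`!%:R * p.2`!%:R)^-1 * wt s.
Proof. by rewrite /wt big_cons natrM invfM natrM. Qed.

Let adm_cons d p s :
  adm d (p :: s) = [&& nz p, (p.1 + p.2 <= d)%N & adm (d - (p.1 + p.2))%N s].
Proof.
rewrite /adm /= big_cons; case: (nz p) => //=; case: (all nz s) => /=.
  apply/eqP/andP => [<-|[le /eqP ->]]; last by rewrite subnKC.
    by rewrite leq_addr addKn.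
by rewrite andbF.
Qed.

Let S_rec k d : S k.+2 d = \sum_(p | nz p && (p.1 + p.2 <= d)%N)
  (p.1`!%:R * p.2`!%:R)^-1 *: op p.1 p.2 (S k.+1 (d - (p.1 + p.2))%N).
Proof.
rewrite /S big_tuple_cons [RHS]big_mkcond; apply: eq_bigr => p _.
case: ifP => [/andP[nzp le]|np]; last first.
  by apply: big_pred0 => s; rewrite /= adm_cons andbA np.
rewrite (big_morph (op p.1 p.2) (opD _ _) (op0 _ _)) scaler_sumr.
apply: eq_big => s; first by rewrite /= adm_cons nzp le.
move=> _; transitivity (wt (p :: s) *: bch_word x y
  ((val p.1, val p.2) :: [seq (val q.1, val q.2) | q <- s])) => //.
rewrite wt_cons opZ word_cons ?scalerA //.
by case/tupleP: s.
Qed.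

Local Notation T := (ft K).
Local Notation E := (fexp 1).
Local Notation U := (E - 1).
(** Generating function, by degree, of the weights of the words with [k+1] pairs that are nonzero
    multiples of [y]. Either [k] pairs [(i, 0)] with [i > 0] precede a last pair [(i, 1)], or
    [k - 1] of them precede [(i, 1), (1, 0)]; the minus sign comes from [[y, x] = -a y]. *)
Let B k : fps K := T * (E * U ^+ k) - (0 < k)%:R * T * (T * (E * U ^+ k.-1)).

Let B0 k : B k 0%N = 0.
Proof. by rewrite /B fcoefB fcoefTM0 [_%:R * T]mulrC -mulrA fcoefTM0 subr0. Qed.

Let BS k : B k.+1 = U * B k - (k == 0%N)%:R * (T * (T * E)).
Proof.
rewrite /B /=; case: k => [|k] /=; rewrite ?expr0 ?mulr0n ?mulr1n ?exprS; ring.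
Qed.

(** A single pair contributes only as [(d - 1, 1)], or as [(1, 0)] in degree 1, which is the source
    of the [x] term. *)
Let S1 d : (d <= m)%N -> S 1 d = (B 0 d * a ^+ d.-1) *: y + (d == 1)%:R *: x.
Proof.
move=> dm; have Bd : B 0 d = if d is d'.+1 then d'`!%:R^-1 else 0.
  rewrite /B ltnn !mul0r subr0 expr0 mulr1; case: (d) => [|d']; first by rewrite fcoefTM0.
  by rewrite fcoefTMS /= expr1n mul1r.
rewrite {}Bd /S big_tuple1 big_mkcond.
rewrite (eq_bigr (fun p : I => if (p.2 == 1%N :> nat) && (p.1.+1 == d) then
   (p.1`!%:R^-1 * a ^+ p.1) *: y
  else if [&& p.2 == 0%N :> nat, p.1 == 1%N :> nat & d == 1%N] then x else 0)); last first.
  move=> -[i j] _; set w := bch_word _ _ _.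
  have {}wE : w = bch_word x y [:: (val i, val j)] by [].
  rewrite /adm /wt /= !big_seq1 /= andbT; clearbody w; case: ifP => [|].
    case/andP => nzij /eqP <-; rewrite wE word1 //.
    move: nzij; rewrite /nz /=; case: (j : nat) => [|[|k]] //= nzij.
    - rewrite addn0 xpair_eqE andbT; case: eqP => [->|_].
        by rewrite (_ : (_ * _)%N = 1%N) ?invr1 ?scale1r.
      by rewrite scaler0.
    - by rewrite addn1 eqxx muln1 scalerA.
    - by rewrite xpair_eqE andbF scaler0.
  rewrite /nz /= => /negbT; rewrite negb_and.
  case: (j : nat) => [|[|k]] /=; rewrite ?addn0 ?orbF ?orbT //=.
    rewrite negbK; case: (i : nat) => [|[|l]] //=; rewrite ?andbF ?orbF //.
    by rewrite [1%N == d]eq_sym => /negPf ->.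
  by rewrite addn1 => /negPf ->.
rewrite -(pair_big xpredT xpredT (fun i j : 'I_m.+1 =>
  if (j == 1%N :> nat) && (i.+1 == d) then (i`!%:R^-1 * a ^+ i) *: y
  else if [&& j == 0%N :> nat, i == 1%N :> nat & d == 1%N] then x else 0)) /=.
rewrite (eq_bigr (fun i : 'I_m.+1 =>
  (if i.+1 == d then (i`!%:R^-1 * a ^+ i) *: y else 0) +
  (if i == 1%N :> nat then (d == 1%N)%:R *: x else 0))); last first.
  move=> i _; rewrite (eq_bigr (fun j : 'I_m.+1 =>
   (if j == 1%N :> nat then if i.+1 == d then (i`!%:R^-1 * a ^+ i) *: y else 0 else 0)
   + (if j == 0%N :> nat then if i == 1%N :> nat then (d == 1%N)%:R *: x else 0 else 0))).
    rewrite big_split /= (sum_delta m.+1 1 (fun=> _)) (sum_delta m.+1 0 (fun=> _)) /=.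
    congr (_ + _); case: (ltnP 1 m.+1) => // m1.
    case: eqP => // id; rewrite -id in dm; have := leq_trans dm m1.
    by rewrite ltn0.
  move=> j _; case: (j : nat) => [|[|k]] /=; rewrite ?addr0 ?add0r //.
  by case: eqP => //= _; case: eqP => //= _; rewrite ?scale1r ?scale0r.
rewrite big_split /= (sum_delta m.+1 1 (fun=> _)); congr (_ + _).
  case: (d) dm => [|d'] dm; first by rewrite mul0r scale0r big1.
  rewrite (eq_bigr (fun i : 'I_m.+1 => if i == d' :> nat then (i`!%:R^-1 * a ^+ i) *: y else 0)) //.
  by rewrite (sum_delta m.+1 d' (fun i => (i`!%:R^-1 * a ^+ i) *: y)) ltnS ltnW.
case: ltnP => // m1; case: eqP => [d1|]; last by rewrite scale0r.
by rewrite d1 leqNgt ltnS in dm; rewrite -ltnS m1 in dm.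
Qed.

(** Induction on the number of pairs, peeling off the first one with [S_rec]. *)
Let S_E k d : (d <= m)%N ->
  S k.+1 d = (B k d * a ^+ d.-1) *: y + ((k == 0%N) && (d == 1%N))%:R *: x.
Proof.
elim: k d => [|k IH] d dm; first exact: S1.
move: (B k) (B k.+1) IH (BS k) (B0 k) => Bk Bk1 IH BSk B0k.
rewrite S_rec big_mkcond /= scale0r addr0.
(* [al i] and [be i] are the contributions of a first pair [(i, 0)] and [(i, 1)]; a larger second
   exponent gives 0. *)
pose al i := if (0 < i <= d)%N then (i`!%:R^-1 * Bk (d - i)%N * a ^+ d.-1) *: y else 0.
pose be i := if (k == 0%N) && (i.+2 == d) then (- (i`!%:R^-1) * a ^+ d.-1) *: y else 0.
rewrite (eq_bigr (fun p : I => (if p.2 == 0%N :> nat then al p.1 else 0)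
   + (if p.2 == 1%N :> nat then be p.1 else 0))); last first.
  move=> [i j] _ /=; rewrite /nz /=; case: ifP => [/andP[nzp le]|np]; last first.
    rewrite /al /be; move: np; case: (j : nat) => [|[|l]] /=; rewrite ?addr0 ?add0r ?orbF ?orbT //=.
      by rewrite addn0 lt0n => ->.
    by rewrite addn1 => /negbT; case: eqP => //= _; case: eqP => //= <-; rewrite leqnSn.
  rewrite IH ?(leq_trans (leq_subr _ _)) // opD !opZ opy opx //.
  rewrite /al /be; move: nzp le; case: (j : nat) => [|[|l]] /=; rewrite ?orbF ?scaler0 ?addr0 ?add0r ?addn0 //.
    rewrite lt0n => -> -> /=; rewrite mulr1 !scalerA -!mulrA; congr (_ *: _); congr (_ * _).
    case: (ltnP i d) => [lt|ge]; last first.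
      by rewrite (eqP ge) B0k !mul0r.
    congr (_ * _); rewrite -exprD; congr (_ ^+ _).
    by move: lt; lia.
  move=> _; rewrite addn1 => lt; rewrite mulr1 !scalerA.
  rewrite (_ : (d - i.+1 == 1)%N = (i.+2 == d)); last by rewrite -(eqn_add2r i.+1) subnK // add1n eq_sym.
  case: andP => [[_ /eqP <-]|_]; last by rewrite mulr0 mul0r scale0r.
  by rewrite mulr1 mulrN mulNr.
  by rewrite scaler0.
rewrite -(pair_big xpredT xpredT (fun i j : 'I_m.+1 =>
  (if j == 0%N :> nat then al i else 0) + (if j == 1%N :> nat then be i else 0))) /=.
rewrite (eq_bigr (fun i : 'I_m.+1 => al i + be i)); last first.
  move=> i _; rewrite big_split /= (sum_delta m.+1 1 (fun=> _)) (sum_delta m.+1 0 (fun=> _)) /=.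
  congr (_ + _); case: ltnP => // m1; rewrite /be; case: eqP => //= _; case: eqP => // id.
  by rewrite -id in dm; have := leq_trans dm m1.
rewrite big_split /= BSk fcoefB mulrBl scalerBl; congr (_ + _).
  (* The pairs [(i, 0)] sum to the convolution [U * B k], whose term [i = 0] vanishes since [U] has
     no constant term. *)
  rewrite fcoefM mulr_suml scaler_suml (big_ord_widen_cond m.+1 xpredT (fun i =>
    (U i * Bk (d - i)%N * a ^+ d.-1) *: y)) // [RHS]big_mkcond.
  apply: eq_bigr => -[[|i] im] _.
    by rewrite fcoefB fcoef1 /= expr0 fact0 divr1 subrr !mul0r scale0r.
  have -> : (U : fps K) i.+1 = i.+1`!%:R^-1.
    by rewrite fcoefB fcoef1 subr0 /= expr1n mul1r.
  by rewrite /al /= ltnS.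
(* A first pair [(i, 1)] contributes only before the single letter [x], that is for [k = 0] and
   [i = d - 2]. *)
rewrite /be; case: (k =P 0%N) => [_|_]; last first.
  by rewrite (_ : (_%:R : fps K) = 0) // big1 // mul0r fcoef0 mul0r scale0r oppr0.
rewrite (_ : (true%:R : fps K) = 1) // mul1r; case: (d) dm => [|[|d']] dm.
- by rewrite big1 // fcoefTM0 mul0r scale0r oppr0.
- by rewrite big1 // fcoefTMS fcoefTM0 mul0r scale0r oppr0.
rewrite (eq_bigr (fun i : 'I_m.+1 => if i == d' :> nat then (- (i`!%:R^-1) * a ^+ d'.+1) *: y else 0)) //.
rewrite (sum_delta m.+1 d' (fun i => (- (i`!%:R^-1) * a ^+ d'.+1) *: y)) ltnS ltnW ?(ltnW dm) //.
by rewrite !fcoefTMS /= expr1n mul1r mulNr scaleNr.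
Qed.

Lemma dynkin_sum k d : (d <= m)%N ->
  \sum_(s : k.+1.-tuple I | adm d s)
    wt s *: bch_word x y [seq (val p.1, val p.2) | p <- s] =
  (B k d * a ^+ d.-1) *: y + ((k == 0%N) && (d == 1%N))%:R *: x.
Proof. exact: S_E. Qed.

End Bound.

(** The inner sums of Dynkin's formula are given by [dynkin_sum] and add up, by [todd_fps_dynkin],
    to [n+1] times a Todd coefficient; the factor [1/(n+1)] of degree [n+1] cancels this. *)
Lemma bch_term_eigen n :
  bch_term n.+1 x y = (todd_fps K n * a ^+ n) *: y + (n == 0%N)%:R *: x.
Proof.
have n0 : n.+1%:R != 0 :> K by rewrite pnatr_eq0.
rewrite /bch_term.
rewrite (eq_big_nat _ _ (F2 := fun k => ((-1) ^+ k.+1 / k%:R *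
     (ft K * (fexp 1 * (fexp 1 - 1) ^+ k.-1) -
       (1 < k)%:R * ft K * (ft K * (fexp 1 * (fexp 1 - 1) ^+ k.-2))) n.+1 * a ^+ n) *: y
    + ((k == 1%N) && (n == 0%N))%:R *: x)); last first.
  move=> [|k] // _; rewrite (@dynkin_sum n.+1 k n.+1) // scalerDr !scalerA.
  congr (_ + _); first by congr (_ *: _); exact: mulrA.
  case: k => [|k] /=; last by rewrite mulr0.
  by rewrite sqrrN expr1n divr1 mul1r eqSS.
rewrite big_split /= -scaler_suml -mulr_suml todd_fps_dynkin scalerDr !scalerA mulrA mulKf //.
congr (_ + _); rewrite big_ltn // big_nat_cond big1 ?addr0 => [|k]; last first.
  by case: k => [|[|k]] //= _; rewrite scale0r.
by case: (n =P 0%N) => [->|_] /=; rewrite ?scaler0 ?scale0r ?scaler0 // invr1 !scale1r.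
Qed.

End Dynkin.

(** * Evaluation of power series *)

Lemma sum_triangle (V : nmodType) (F : nat -> nat -> V) N :
  \sum_(n < N) \sum_(i < n.+1) F i (n - i)%N =
  \sum_(i < N) \sum_(j < N - i) F i j.
Proof.
rewrite (eq_bigr (fun n : 'I_N => \sum_(i < N | (i <= n)%N) F i (n - i)%N)); last first.
  by move=> n _; rewrite (big_ord_widen N (fun i => F i (n - i)%N)).
rewrite (exchange_big_dep xpredT) //=; apply: eq_bigr => i _.
rewrite -(big_mkord xpredT (fun j => F i j)) -[in RHS](add0n (N - i)%N).
rewrite -(big_mkord (fun n => (i <= n)%N) (fun n => F i (n - i)%N)).
rewrite (big_cat_nat (n := i)) //= ?(ltnW (ltn_ord i)) //.
rewrite big_nat_cond big1 ?add0r => [|n /andP[/andP[_ ni]]]; last by rewrite leqNgt ni.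
rewrite -{1}(add0n (i : nat)) big_addn add0n [LHS]big_nat_cond [RHS]big_nat_cond.
by apply: eq_big => n; rewrite ?leq_addl ?addnK ?andbT.
Qed.

Lemma cvgn_ext (T : topologicalType) (u v : nat -> T) (l : T) :
  (forall n, u n = v n) -> u @ \oo --> l -> v @ \oo --> l.
Proof. by move=> /funext ->. Qed.

Section SeriesSums.
Variable R : realType.
Local Notation C := R[i].

Lemma ccvgB (u v : nat -> C) (F G : C) : u @ \oo --> F -> v @ \oo --> G ->
  u n - v n @[n --> \oo] --> F - G.
Proof. by move=> uF vG; exact: (@cvgB _ R[i] _ _ _ u v F G uF vG). Qed.

Lemma ccvgD (u v : nat -> C) (F G : C) : u @ \oo --> F -> v @ \oo --> G ->
  u n + v n @[n --> \oo] --> F + G.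
Proof. by move=> uF vG; exact: (@cvgD _ R[i] _ _ _ u v F G uF vG). Qed.

Lemma ccvgM (u v : nat -> C) (F G : C) : u @ \oo --> F -> v @ \oo --> G ->
  u n * v n @[n --> \oo] --> F * G.
Proof. by move=> uF vG; exact: (@cvgM R[i] _ _ _ u v F G uF vG). Qed.

Lemma ccvgV (u : nat -> C) (F : C) : F != 0 -> u @ \oo --> F ->
  (u n)^-1 @[n --> \oo] --> F^-1.
Proof. by move=> F0 uF; exact: (@cvgV R[i] _ _ _ u F F0 uF). Qed.

Lemma ccvg_unique (u : nat -> C) (F G : C) :
  u @ \oo --> F -> u @ \oo --> G -> F = G.
Proof. exact: (@cvg_unique R[i] (@norm_hausdorff _ R[i])). Qed.

Implicit Types (a b : nat -> C) (f g : fps C) (h F G : C).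

Definition summable a := exists M : C, forall N, \sum_(n < N) `|a n| <= M.

(** Absolute convergence is included so that Cauchy products can be formed. *)
Definition has_sum a F := summable a /\ (\sum_(n < N) a n @[N --> \oo] --> F).

Definition fps_eval f h F := has_sum (fun n => f n * h ^+ n) F.

Lemma summable_ge0 a : summable a ->
  exists2 M : C, 0 <= M & forall N, \sum_(n < N) `|a n| <= M.
Proof. by case=> M aM; exists M => //; have := aM 0%N; rewrite big_ord0. Qed.

(** The partial sums of the moduli are nondecreasing bounded reals; [N0] is where they come within
    [e] of their supremum. *)
Lemma summable_tail a (e : C) : summable a -> 0 < e ->
  exists N0, forall N, \sum_(N0 <= n < N) `|a n| <= e.
Proof.
move=> /summable_ge0[M M0 aM] e0.
pose u N : R := complex.Re (\sum_(n < N) `|a n|).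
have uE N : \sum_(n < N) `|a n| = (u N)%:C.
  by rewrite [LHS]complexE ger0_Im ?mulr0 ?addr0 // sumr_ge0.
have hs : has_sup [set u N | N in [set: nat]].
  split; first by exists (u 0%N), 0%N.
  exists (complex.Re M) => _ [N _ <-].
  by have := aM N; rewrite uE lecE => /andP[].
have e0' : 0 < complex.Re e by move: e0; rewrite ltcE => /andP[].
have eE : e = (complex.Re e)%:C.
  by rewrite [LHS]complexE ger0_Im ?mulr0 ?addr0 // ltW.
have [_ [N0 _ <-] uN0] := sup_adherent e0' hs.
exists N0 => N; case: (leqP N N0) => [NN0|/ltnW N0N].
  by rewrite big_geq // ltW.
have : \sum_(n < N) `|a n| = \sum_(n < N0) `|a n| + \sum_(N0 <= n < N) `|a n|.
  by rewrite -!(big_mkord xpredT (fun n => `|a n|)) -big_cat_nat.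
rewrite !uE => /eqP; rewrite addrC -subr_eq => /eqP <-.
rewrite eE -rmorphB lecR lerBlDr.
have : u N <= sup [set u N | N in [set: nat]].
  by apply: ub_le_sup; [case: hs | exists N].
move: uN0; lra.
Qed.

Lemma sum_conv a b N :
  \sum_(n < N) \sum_(i < n.+1) a i * b (n - i)%N =
  \sum_(i < N) a i * \sum_(j < N - i) b j.
Proof.
rewrite (sum_triangle (fun i j => a i * b j)).
by apply: eq_bigr => i _; rewrite mulr_sumr.
Qed.

Lemma summable_conv a b : summable a -> summable b ->
  summable (fun n => \sum_(i < n.+1) a i * b (n - i)%N).
Proof.
move=> /summable_ge0[A A0 aA] /summable_ge0[B B0 bB]; exists (A * B) => N.
apply: (@le_trans _ _ (\sum_(n < N) \sum_(i < n.+1) `|a i| * `|b (n - i)%N|)).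
  apply: ler_sum => n _; apply: le_trans (ler_norm_sum _ _ _) _.
  by apply: ler_sum => i _; rewrite normrM.
rewrite (sum_conv (fun i => `|a i|) (fun i => `|b i|)).
apply: (@le_trans _ _ (\sum_(i < N) `|a i| * B)).
  by apply: ler_sum => i _; rewrite ler_wpM2l.
by rewrite -mulr_suml ler_wpM2r.
Qed.

(** The pairs [(i, j)] of the square outside the triangle [i + j < N] have [i] or [j] large, so
    their contribution is bounded by tails of the two absolutely convergent series. *)
Lemma cvg_conv_sub a b : summable a -> summable b ->
  (\sum_(i < N) a i) * (\sum_(j < N) b j) -
    \sum_(n < N) \sum_(i < n.+1) a i * b (n - i)%N @[N --> \oo] --> (0 : C).
Proof.
move=> sa sb; have [A A0 aA] := summable_ge0 sa; have [B B0 bB] := summable_ge0 sb.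
apply/cvgrPdist_le => e e0; have AB0 : 0 < A + B + 1.
  by rewrite ltr_wpDl // addr_ge0.
(* With tails at most this value, the two parts of the final bound add up to
   [(A + B) e / (A + B + 1)], hence to at most [e]. *)
have e' : 0 < e / (A + B + 1) by rewrite divr_gt0.
have [N1 tb] := summable_tail sb e'; have [N2 ta] := summable_tail sa e'.
pose N0 := maxn N1 N2.
(* For [N >= 2 N0], every [i < N0] leaves [N - i >= N1], where the tail of [b] is small. *)
near=> N; have N0N : (N0 + N0 <= N)%N by near: N; exact: nbhs_infty_ge.
rewrite sub0r normrN sum_conv mulr_suml -sumrB.
apply: le_trans (ler_norm_sum _ _ _) _.
have lt (i : 'I_N) : `|a i * (\sum_(j < N) b j) - a i * \sum_(j < N - i) b j|
    <= `|a i| * \sum_(N - i <= j < N) `|b j|.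
  rewrite -mulrBr normrM ler_wpM2l //.
  rewrite -!(big_mkord xpredT b) (@big_cat_nat _ _ _ (N - i)) //= ?leq_subr //.
  by rewrite addrAC subrr add0r; exact: ler_norm_sum.
apply: (@le_trans _ _ (\sum_(i < N) (`|a i| * (e / (A + B + 1)) + (if (N0 <= i)%N then `|a i| * B else 0)))).
  apply: ler_sum => i _; apply: le_trans (lt i) _; case: leqP => iN0.
    rewrite -[leLHS]add0r; apply: lerD; first by rewrite mulr_ge0 // ltW.
    rewrite ler_wpM2l //; apply: le_trans (bB N).
    rewrite -(big_mkord xpredT (fun j => `|b j|)) [leRHS](@big_cat_nat _ _ _ (N - i)) //= ?leq_subr //.
    by rewrite lerDr sumr_ge0.
  rewrite addr0 ler_wpM2l //; apply: le_trans (tb N).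
  have N1i : (N1 <= N - i)%N.
    by move: N0N iN0; rewrite /N0; lia.
  by rewrite [leRHS](@big_cat_nat _ _ _ (N - i)) //= ?leq_subr // lerDr sumr_ge0.
rewrite big_split /= -mulr_suml.
have -> : \sum_(i < N) (if (N0 <= i)%N then `|a i| * B else 0) =
    (\sum_(N0 <= i < N) `|a i|) * B.
  rewrite -big_mkcond mulr_suml -(big_mkord (fun i => (N0 <= i)%N) (fun i => `|a i| * B)).
  rewrite (@big_cat_nat _ _ _ N0) //=; last by apply: leq_trans N0N; exact: leq_addr.
  rewrite big_nat_cond big1 ?add0r => [|i /andP[/andP[_ iN]]]; last by rewrite leqNgt iN.
  by rewrite [LHS]big_nat_cond [RHS]big_nat_cond; apply: eq_bigl => i; case: (N0 <= i)%N; rewrite ?andbF.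
have t2 : \sum_(N0 <= i < N) `|a i| <= e / (A + B + 1).
  apply: le_trans (ta N); rewrite [leRHS](@big_cat_nat _ _ _ N0) //= ?leq_maxr //.
    by rewrite lerDr sumr_ge0.
  by apply: leq_trans N0N; exact: leq_addr.
apply: (@le_trans _ _ (A * (e / (A + B + 1)) + (e / (A + B + 1)) * B)).
  by apply: lerD; apply: ler_wpM2r => //; [exact: ltW | exact: aA].
rewrite [A * _]mulrC -mulrDr -[leRHS](divfK (lt0r_neq0 AB0)).
by rewrite ler_wpM2l ?(ltW e') // lerDl.
Unshelve. all: end_near. Qed.

Lemma has_sum_conv a b F G : has_sum a F -> has_sum b G ->
  has_sum (fun n => \sum_(i < n.+1) a i * b (n - i)%N) (F * G).
Proof.
move=> [sa aF] [sb bG]; split; first exact: summable_conv.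
have := ccvgB (ccvgM aF bG) (cvg_conv_sub sa sb); rewrite subr0.
by apply: cvgn_ext => N; rewrite subKr.
Qed.

Lemma has_sumD a b F G : has_sum a F -> has_sum b G ->
  has_sum (fun n => a n + b n) (F + G).
Proof.
move=> [[A aA] aF] [[B bB] bG]; split.
  exists (A + B) => N; apply: le_trans (lerD (aA N) (bB N)).
  by rewrite -big_split ler_sum // => i _; rewrite ler_normD.
by apply: cvgn_ext (ccvgD aF bG) => N; rewrite big_split.
Qed.

Lemma has_sumZ k a F : has_sum a F -> has_sum (fun n => k * a n) (k * F).
Proof.
move=> [[A aA] aF]; split.
  exists (`|k| * A) => N; rewrite (eq_bigr (fun n : 'I_N => `|k| * `|a n|)).
    by rewrite -mulr_sumr; apply: ler_wpM2l => //; exact: aA.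
  by move=> i _; rewrite normrM.
by apply: cvgn_ext (ccvgM (cvg_cst k) aF) => N; rewrite mulr_sumr.
Qed.

Lemma fps_eval_mul f g h F G :
  fps_eval f h F -> fps_eval g h G -> fps_eval (f * g) h (F * G).
Proof.
move=> fF gG; rewrite /fps_eval (_ : (fun n => _) = fun n =>
  \sum_(i < n.+1) (f i * h ^+ i) * (g (n - i)%N * h ^+ (n - i)%N)).
  exact: has_sum_conv fF gG.
apply/funext => n; rewrite fcoefM mulr_suml; apply: eq_bigr => i _.
by rewrite mulrACA -exprD subnKC // -ltnS.
Qed.

Lemma fps_evalD f g h F G :
  fps_eval f h F -> fps_eval g h G -> fps_eval (f + g) h (F + G).
Proof.
move=> fF gG; rewrite /fps_eval (_ : (fun n => _) = fun n =>
  f n * h ^+ n + g n * h ^+ n).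
  exact: has_sumD fF gG.
by apply/funext => n; rewrite fcoefD mulrDl.
Qed.

Lemma has_sum_finite a N0 : (forall n, (N0 <= n)%N -> a n = 0) ->
  has_sum a (\sum_(n < N0) a n).
Proof.
move=> a0.
have sE (V : nmodType) (b : nat -> V) N : (forall n, (N0 <= n)%N -> b n = 0) ->
    (N0 <= N)%N -> \sum_(n < N) b n = \sum_(n < N0) b n.
  move=> b0 NN; rewrite -!(big_mkord xpredT b) (@big_cat_nat _ _ _ N0) //=.
  rewrite [X in _ + X]big_nat_cond [X in _ + X]big1 ?addr0 // => n.
  by case/andP => /andP[/b0].
split.
  exists (\sum_(n < N0) `|a n|) => N; case: (leqP N N0) => NN; last first.
    have na n : (N0 <= n)%N -> `|a n| = 0 by move=> /a0 ->; rewrite normr0.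
    by rewrite (sE C _ N na (ltnW NN)).
  rewrite -!(big_mkord xpredT (fun n => `|a n|)) [leRHS](@big_cat_nat _ _ _ N) //=.
  by rewrite lerDl sumr_ge0.
apply: cvg_near_cst; near=> N; apply: (sE C a N a0).
by near: N; exact: nbhs_infty_ge.
Unshelve. all: end_near. Qed.

Lemma fps_eval0 f : fps_eval f 0 (f 0%N).
Proof.
rewrite /fps_eval; have := @has_sum_finite (fun n => f n * 0 ^+ n) 1.
rewrite big_ord1 mulr1; apply => -[|n] // _.
by rewrite expr0n mulr0.
Qed.

Lemma fps_eval_const c h : fps_eval (fconst c) h c.
Proof.
rewrite /fps_eval; have := @has_sum_finite (fun n => fconst c n * h ^+ n) 1.
rewrite big_ord1 mulr1; apply => -[|n] // _.
by rewrite mul0r.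
Qed.

Lemma fps_eval_t h : fps_eval (ft C) h h.
Proof.
rewrite /fps_eval; have := @has_sum_finite (fun n => ft C n * h ^+ n) 2.
rewrite big_ord_recl big_ord1 /= mul0r add0r mul1r; apply => -[|[|n]] // _.
by rewrite mul0r.
Qed.

(** The product of the partial sums of [f] and [g] tends to 1, because the Cauchy product is exactly
    1. Those of [g] being bounded, [F] cannot vanish; dividing by those of [f] then gives the limit
    for [g]. *)
Lemma fps_eval_inv f g h F : f * g = 1 -> fps_eval f h F ->
  summable (fun n => g n * h ^+ n) -> F != 0 /\ fps_eval g h F^-1.
Proof.
move=> fg [sf fF] sg; have [B B0 gB] := summable_ge0 sg.
pose sF N := \sum_(n < N) f n * h ^+ n; pose sG N := \sum_(n < N) g n * h ^+ n.
have FG1 : sF N * sG N @[N --> \oo] --> (1 : C).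
  have := cvg_conv_sub sf sg => /(ccvgD (cvg_cst (1 : C))); rewrite addr0.
  apply: cvg_trans; apply: near_eq_cvg; near=> N.
  have N0 : (0 < N)%N by near: N; exact: nbhs_infty_gt.
  suff -> : \sum_(n < N) \sum_(i < n.+1) f i * h ^+ i * (g (n - i)%N * h ^+ (n - i)) = 1.
    by rewrite addrC subrK.
  rewrite (eq_bigr (fun n : 'I_N => (f * g) n * h ^+ n)) => [|n _]; last first.
    rewrite fcoefM mulr_suml; apply: eq_bigr => i _.
    by rewrite mulrACA -exprD subnKC // -ltnS.
  rewrite fg (bigD1 (Ordinal N0)) //= expr0 mulr1 big1 ?addr0 // => i i0.
  by rewrite ifN ?mul0r.
have F0 : F != 0.
  apply/eqP => F0; rewrite F0 in fF.
  suff /ccvg_unique/(_ FG1) : sF N * sG N @[N --> \oo] --> (0 : C).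
    by move/eqP; rewrite eq_sym oner_eq0.
  have B1 : 0 < B + 1 by rewrite ltr_wpDl.
  apply/cvgrPdist_le => e e0; near=> N.
  rewrite sub0r normrN normrM.
  apply: (@le_trans _ _ (e / (B + 1) * (B + 1))); last by rewrite divfK ?lt0r_neq0.
  apply: ler_pM => //; last first.
    by apply: le_trans (ler_norm_sum _ _ _) _; rewrite (le_trans (gB N)) // lerDl.
  rewrite -normrN -sub0r; near: N; move/cvgrPdist_le: fF; apply.
  by apply: divr_gt0; [exact: e0 | exact: B1].
split; first exact: F0.
split; first exact: sg.
have := ccvgM FG1 (ccvgV F0 fF); rewrite mul1r.
apply: cvg_trans; apply: near_eq_cvg; near=> N.
have FN0 : sF N != 0.
  have : `|F - sF N| < `|F|.
    by near: N; move/cvgrPdist_lt: fF; apply; rewrite normr_gt0.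
  by apply: contraTneq => ->; rewrite subr0 ltxx.
by rewrite -/(sF N) -/(sG N) mulrC mulKf.
Unshelve. all: end_near. Qed.
End SeriesSums.

(** * The complex exponential *)

Section ComplexExp.
Variable R : realType.
Local Notation C := R[i].
Implicit Types (x y : R) (z w h c q : C).

Lemma normc_real x : `|x%:C| = `|x|%:C.
Proof. by rewrite normc_def /= expr0n addr0 sqrtr_sqr. Qed.

Lemma gt0_complexE c : 0 < c -> c = (complex.Re c)%:C /\ 0 < complex.Re c.
Proof.
move=> c0; split; last by move: c0; rewrite ltcE => /andP[].
by rewrite [LHS]complexE ger0_Im ?mulr0 ?addr0 // ltW.
Qed.

Lemma cvg_real_complex (u : nat -> R) (l : R) :
  u @ \oo --> l -> (u n)%:C @[n --> \oo] --> l%:C.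
Proof.
move=> ul; apply/cvgrPdist_le => e e0.
have [eE e0'] := gt0_complexE e0.
near=> n; rewrite -rmorphB normc_real eE lecR.
by near: n; move/cvgrPdist_le: ul; apply.
Unshelve. all: end_near. Qed.

Lemma has_sum_real (u v : nat -> R) (l : R) :
  (forall n, `|u n| <= v n) -> cvgn (series v) -> series u @ \oo --> l ->
  has_sum (fun n => (u n)%:C) l%:C.
Proof.
move=> uv cv ul; split.
  exists (limn (series v))%:C => N.
  rewrite (eq_bigr (fun n : 'I_N => (`|u n|)%:C)) => [|n _]; last exact: normc_real.
  rewrite -rmorph_sum lecR; apply: le_trans (nondecreasing_cvgn_le _ cv N).
    by rewrite /series /= big_mkord ler_sum.
  by apply/nondecreasing_seqP => n; rewrite !seriesEnat /= big_nat_recr //= lerDl (le_trans _ (uv n)).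
by apply: cvgn_ext (cvg_real_complex ul) => N; rewrite /series /= big_mkord rmorph_sum.
Qed.

Let fexp_at1 z l : has_sum (fun n => z ^+ n / n`!%:R) l -> fps_eval (fexp z) 1 l.
Proof.
by rewrite /fps_eval; congr (has_sum _ l); apply/funext => n; rewrite expr1n mulr1.
Qed.

Lemma fps_eval_expR x : fps_eval (fexp x%:C) 1 (expR x)%:C.
Proof.
apply: fexp_at1.
have := @has_sum_real (exp_coeff x) (exp_coeff `|x|) (expR x).
rewrite (_ : (fun n => _) = (fun n => (exp_coeff x n)%:C)); last first.
  by apply/funext => n; rewrite /exp_coeff /= rmorphM rmorphXn fmorphV rmorph_nat.
apply.
- by move=> n; rewrite /exp_coeff /= normrM normrX normfV normr_nat.
- exact: is_cvg_series_exp_coeff.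
- exact: is_cvg_series_exp_coeff.
Qed.

Lemma expc_i n : ('i : C) ^+ n = (-1) ^+ n./2 * (if odd n then 'i else 1).
Proof.
rewrite -{1}(odd_double_half n) exprD -muln2 mulnC exprM sqr_i mulrC.
by case: (odd n).
Qed.

(** The powers of [i] separate the exponential series by parity into the cosine and sine series. *)
Lemma fps_eval_cis y : fps_eval (fexp (0 +i* y)) 1 (cos y +i* sin y).
Proof.
apply: fexp_at1.
have -> : cos y +i* sin y = (cos y)%:C + 'i * (sin y)%:C by rewrite [LHS]complexE.
rewrite (_ : (fun n => _) = (fun n => (cos_coeff y n)%:C + 'i * (sin_coeff y n)%:C)); last first.
  apply/funext => n; have -> : 0 +i* y = 'i * y%:C.
    by rewrite [LHS]complexE add0r.
  rewrite exprMn expc_i /cos_coeff /sin_coeff /= !rmorphM !rmorphXn !fmorphV !rmorph_nat rmorphN rmorph1.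
  have [on|en] := boolP (odd n) => /=; last first.
    by rewrite !mul0r mulr0 addr0 mul1r mulr1.
  rewrite !mul0r add0r mul1r (_ : n.-1./2 = n./2); last first.
    by move: on; case: (n) => //= m; rewrite uphalf_half => /negPf ->.
  by rewrite -!mulrA mulrCA.
apply: has_sumD; last apply: has_sumZ.
- apply: (@has_sum_real _ (exp_coeff `|y|)).
  + move=> n; rewrite /cos_coeff /exp_coeff /= !normrM normfV !normr_nat !normrX normrN normr1 expr1n mulr1.
    by case: odd; rewrite ?mul0r ?mul1r // divr_ge0.
  + exact: is_cvg_series_exp_coeff.
  + by rewrite unlock; exact: is_cvg_series_cos_coeff.
- apply: (@has_sum_real _ (exp_coeff `|y|)).
  + move=> n; rewrite /sin_coeff /exp_coeff /= !normrM normfV !normr_nat !normrX normrN normr1 expr1n mulr1.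
    by case: odd; rewrite ?mul0r ?mul1r // divr_ge0.
  + exact: is_cvg_series_exp_coeff.
  + by rewrite unlock; exact: is_cvg_series_sin_coeff.
Qed.

(** The value at [h] is that of [fexp (c * h)] at 1, where the series is the product of those of the
    real and imaginary parts. *)
Lemma fps_eval_exp c h : fps_eval (fexp c) h (cexp (c * h)).
Proof.
have : fps_eval (fexp (c * h)) 1 (cexp (c * h)).
  case: (c * h) => x y; rewrite (_ : x +i* y = x%:C + (0 +i* y)); last first.
    by apply/eqP; rewrite eq_complex /= addr0 add0r !eqxx.
  rewrite -fexpD /cexp /= add0r addr0; apply: fps_eval_mul.
    exact: fps_eval_expR.
  exact: fps_eval_cis.
rewrite /fps_eval; congr (has_sum _ _); apply/funext => n /=.
by rewrite expr1n mulr1 exprMn mulrAC.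
Qed.

Lemma cexpD z w : cexp (z + w) = cexp z * cexp w.
Proof.
have zw := fps_eval_mul (fps_eval_exp z 1) (fps_eval_exp w 1).
rewrite fexpD !mulr1 in zw.
have := fps_eval_exp (z + w) 1; rewrite mulr1 => -[_ l1].
by have [_ l2] := zw; exact: ccvg_unique l1 l2.
Qed.

Lemma cosD2pi_int y (k : int) : cos (y + k%:~R * (2 * pi)) = cos y.
Proof.
have nat_case (u : R) n : cos (u + n%:R * (2 * pi)) = cos u.
  by rewrite !mulr_natl (periodicn (@cosD2pi R)).
case: k => n; first exact: nat_case.
by rewrite NegzE mulrNz mulNr -{2}(subrK (n.+1%:R * (2 * pi)) y) nat_case.
Qed.

Lemma sinD2pi_int y (k : int) : sin (y + k%:~R * (2 * pi)) = sin y.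
Proof.
have nat_case (u : R) n : sin (u + n%:R * (2 * pi)) = sin u.
  by rewrite !mulr_natl (periodicn (@sinD2pi R)).
case: k => n; first exact: nat_case.
by rewrite NegzE mulrNz mulNr -{2}(subrK (n.+1%:R * (2 * pi)) y) nat_case.
Qed.

Lemma int_twopiiE (k : int) : k%:~R * twopii R = 0 +i* (k%:~R * (2 * pi)).
Proof.
have -> : k%:~R = (k%:~R : R)%:C by rewrite rmorph_int.
by apply/eqP; rewrite eq_complex /= !(mul0r, mulr0, subr0, addr0) !eqxx.
Qed.

Lemma cexp_int_twopii (k : int) : cexp (k%:~R * twopii R) = 1.
Proof.
rewrite int_twopiiE /cexp /= expR0 -[k%:~R * _]add0r cosD2pi_int sinD2pi_int.
by rewrite cos0 sin0 mul1r.
Qed.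

(** The argument is reduced to [t] in [[0, 2 pi)]; if [t > 0] then [sin(t/2) > 0], against
    [cos t = 1 - 2 sin(t/2)^2]. *)
Lemma cos_eq1 y : cos y = 1 -> exists k : int, y = k%:~R * (2 * pi).
Proof.
move=> cy; have p0 : 0 < 2 * pi :> R by rewrite mulr_gt0 // pi_gt0.
pose k := Num.floor (y / (2 * pi)); exists k.
pose t := y - k%:~R * (2 * pi).
have t0 : 0 <= t by rewrite subr_ge0 -ler_pdivlMr // floor_le.
have t1 : t < 2 * pi.
  have := floorD1_gt (y / (2 * pi)); rewrite ltr_pdivrMr // -/k intrD mulrDl mul1r.
  by rewrite /t ltrBlDl.
have ct : cos t = 1 by rewrite -(cosD2pi_int t k) /t subrK.
apply/eqP; rewrite -subr_eq0 -/t; apply/eqP/le_anti; rewrite t0 andbT leNgt.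
apply/negP => t0'; have : 0 < sin (t / 2).
  by rewrite sin_gt0_pi // divr_gt0 //= ltr_pdivrMr // mulrC.
have : cos (t / 2 *+ 2) = 1 by rewrite -mulr_natr divfK // pnatr_eq0.
rewrite cos_mulr2n => c2 s0; have := cos2Dsin2 (t / 2).
by move: s0 c2; nra.
Qed.

Lemma cexp_eq1 z : cexp z = 1 -> exists k : int, z = k%:~R * twopii R.
Proof.
case: z => x y; rewrite /cexp /= => /eqP; rewrite eq_complex /=.
rewrite !(mul0r, subr0, addr0) => /andP[/eqP e1 /eqP e2].
have ex := expR_gt0 x.
have s0 : sin y = 0 by move/eqP: e2; rewrite mulf_eq0 gt_eqF //= => /eqP.
have c0 : 0 < cos y by rewrite -(pmulr_rgt0 _ ex) e1.
have c1 : cos y = 1 by have := cos2Dsin2 y; rewrite s0; move: c0; nra.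
have [k ky] := cos_eq1 c1; exists k.
rewrite int_twopiiE -ky; congr (_ +i* _).
by apply: expR_inj; rewrite expR0 -[LHS]mulr1 -c1 e1.
Qed.

End ComplexExp.

(** * Radius of convergence of the Todd series *)

Section Riccati.
Variable R : realType.
Variable s : nat -> R.
Hypothesis s_ge0 : forall n, 0 <= s n.
Hypothesis s0 : s 0%N = 0.
Hypothesis s_riccati : forall n,
  n.+1%:R * s n <= (n == 2)%:R / 4 + \sum_(i < n.+1) s i * s (n - i)%N.
Variable N : nat.
Implicit Types x : R.

Let S := \poly_(i < N) s i.
(** The primitive of [S / x] vanishing at 0; [expR (- Q)] serves as an integrating factor in [G]. *)
Let Q := \poly_(i < N) (s i / i%:R).

Let SE x : S.[x] = \sum_(i < N) s i * x ^+ i.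
Proof. exact: horner_poly. Qed.

Let coefS i : S`_i = if (i < N)%N then s i else 0.
Proof. exact: coef_poly. Qed.
Let coefQ i : Q`_i = if (i < N)%N then s i / i%:R else 0.
Proof. exact: coef_poly. Qed.

Let XQ' : 'X * Q^`() = S.
Proof.
apply/polyP => i; rewrite coefXM coefS; case: i => [|i] /=.
  by rewrite s0 if_same.
rewrite coef_deriv coefQ; case: ifP => _; last by rewrite mul0rn.
by rewrite -[LHS]mulr_natr divfK // pnatr_eq0.
Qed.

(** The recursion multiplied by [x^n] and summed; the truncated convolution is at most [S^2] because
    all its terms are nonnegative. *)
Let poly_riccati x : 0 <= x -> x * S^`().[x] + S.[x] <= x ^+ 2 / 4 + S.[x] ^+ 2.
Proof.
move=> x0.
have sx0 n : 0 <= s n * x ^+ n by rewrite mulr_ge0 // exprn_ge0.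
have -> : x * S^`().[x] + S.[x] = \sum_(i < N) (i.+1%:R * s i) * x ^+ i.
  have -> : x * S^`().[x] = ('X * S^`()).[x] by rewrite hornerM hornerX.
  have -> : 'X * S^`() = \poly_(i < N) (i%:R * s i).
    apply/polyP => i; rewrite coefXM coef_poly; case: i => [|i] /=.
      by rewrite mul0r if_same.
    by rewrite coef_deriv coefS mulr_natl; case: ifP; rewrite ?mul0rn.
  rewrite SE horner_poly -big_split; apply: eq_bigr => i _ /=.
  by rewrite -[i.+1%:R]natr1 [(_ + 1) * _]mulrDl mul1r mulrDl.
apply: (@le_trans _ _ (\sum_(n < N) ((n == 2 :> nat)%:R / 4 * x ^+ n +
   \sum_(i < n.+1) (s i * x ^+ i) * (s (n - i)%N * x ^+ (n - i))))).
  apply: ler_sum => n _; rewrite (eq_bigr (fun i : 'I_n.+1 => s i * s (n - i)%N * x ^+ n)).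
    by rewrite -mulr_suml -mulrDl ler_wpM2r // exprn_ge0.
  by move=> i _; rewrite mulrACA -exprD subnKC // -ltnS.
rewrite big_split lerD //=.
  rewrite (eq_bigr (fun i : 'I_N => if i == 2 :> nat then x ^+ i / 4 else 0)).
    rewrite -big_mkcond /=; case: (ltnP 2 N) => N2.
      by rewrite (big_pred1 (Ordinal N2)).
    rewrite big1 => [|i /eqP i2]; first by rewrite divr_ge0 // sqr_ge0.
    by have := ltn_ord i; rewrite i2 ltnNge N2.
  by move=> i _; case: eqP; rewrite ?mul0r // mulrC mul1r.
rewrite (sum_triangle (fun i j => s i * x ^+ i * (s j * x ^+ j))) expr2 SE mulr_suml.
apply: ler_sum => i _; rewrite -mulr_sumr ler_wpM2l //.
rewrite -!(big_mkord xpredT (fun j => s j * x ^+ j)) [leRHS](@big_cat_nat _ _ _ (N - i)) //= ?leq_subr //.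
by rewrite lerDl sumr_ge0.
Qed.

Let hx x := 2^-1 * x.
(** [sin(x/2)] times the difference between [1 - (x/2) cot(x/2)] and [S], written without
    division. *)
Let H x := sin (hx x) - hx x * cos (hx x) - S.[x] * sin (hx x).
Let H' x := 2^-1 * (hx x * sin (hx x) - S.[x] * cos (hx x)) - S^`().[x] * sin (hx x).
Let G x := H x * expR (- Q.[x]).

Let is_derive_G x : is_derive x 1 G ((H' x - H x * Q^`().[x]) * expR (- Q.[x])).
Proof.
have dh : is_derive x 1 hx 2^-1.
  by apply: (@is_derive_eq _ _ _ (2^-1 *: id)); rewrite /GRing.scale /= mulr1.
have ds : is_derive x 1 (fun t => sin (hx t)) (cos (hx x) * 2^-1).
  exact: (@is_derive1_comp _ sin hx).
have dc : is_derive x 1 (fun t => cos (hx t)) (- sin (hx x) * 2^-1).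
  exact: (@is_derive1_comp _ cos hx).
have de : is_derive x 1 (fun t => expR (- Q.[t])) (expR (- Q.[x]) * - Q^`().[x]).
  apply: (@is_derive1_comp _ expR (fun t => - Q.[t])).
have dH : is_derive x 1 H (H' x).
  have -> : H = (fun t => sin (hx t)) - hx * (fun t => cos (hx t)) - horner S * (fun t => sin (hx t)).
    by [].
  by apply: is_derive_eq; rewrite /H' /GRing.scale /=; field.
have -> : G = H * (fun t => expR (- Q.[t])) by [].
by apply: is_derive_eq; rewrite /GRing.scale /=; ring.
Qed.

(** [G] vanishes at 0 and is nondecreasing: [t G'(t)] is the slack in [poly_riccati] times
    [sin(t/2)] and an exponential, hence nonnegative on [[0, 2 pi]]. *)
Lemma riccati_majorant x : 0 <= x <= 2 * pi ->
  (\sum_(i < N) s i * x ^+ i) * sin (x / 2) <= sin (x / 2) - x / 2 * cos (x / 2).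
Proof.
move=> /andP[x0 x1].
have p0 : 0 < 2 * pi :> R by rewrite mulr_gt0 // pi_gt0.
have G0 : G 0 = 0.
  by rewrite /G /H /hx !mulr0 sin0 mulr0 mul0r !subr0 mul0r.
have : G 0 <= G x.
  apply: (@ger0_derive1_ndecr _ G 0 (2 * pi)) => [t _|t||//|//|//].
  - exact: (@ex_derive _ _ _ _ _ _ _ (is_derive_G t)).
  - rewrite in_itv /= => /andP[t0 t1].
    rewrite derive1E (@derive_val _ _ _ _ _ _ _ (is_derive_G t)).
    apply: mulr_ge0; last exact: expR_ge0.
    rewrite -(pmulr_rge0 _ t0).
    have -> : t * (H' t - H t * Q^`().[t]) = t * H' t - H t * S.[t].
      by rewrite -XQ' hornerM hornerX; ring.
    have sin0' : 0 <= sin (hx t).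
      rewrite sin_ge0_pi // /hx mulr_ge0 ?ltW //=.
      by move: t1; lra.
    have -> : t * H' t - H t * S.[t] =
      sin (hx t) * (t ^+ 2 / 4 + S.[t] ^+ 2 - (t * S^`().[t] + S.[t])).
      by rewrite /H /H' /hx; field.
    by rewrite mulr_ge0 // subr_ge0 poly_riccati // ltW.
  - apply: derivable_within_continuous => t _; exact: (@ex_derive _ _ _ _ _ _ _ (is_derive_G t)).
rewrite G0 /G pmulr_lge0 ?expR_gt0 // /H SE subr_ge0 /hx.
by rewrite [2^-1 * x]mulrC.
Qed.

End Riccati.

Section Todd.
Variable R : realType.
Local Notation C := R[i].
Local Notation tau := (todd_fps C).
Implicit Types (x y : R) (z w h c q : C).

Lemma normcE z : `|z| = (normc z)%:C. Proof. by []. Qed.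

Lemma normc_ge0 z : 0 <= normc z.
Proof. by case: z => x y; exact: sqrtr_ge0. Qed.

Lemma summableD (a b : nat -> C) :
  summable a -> summable b -> summable (fun n => a n + b n).
Proof.
move=> [A aA] [B bB]; exists (A + B) => N; apply: le_trans (lerD (aA N) (bB N)).
by rewrite -big_split; apply: ler_sum => i _; exact: ler_normD.
Qed.

Lemma summable_le (a : nat -> C) (b : nat -> C) :
  (forall n, `|a n| <= `|b n|) -> summable b -> summable a.
Proof.
by move=> ab [B bB]; exists B => N; apply: le_trans (bB N); exact: ler_sum.
Qed.

Let sigma : fps C := tau - 1 - fconst 2^-1 * ft C.

Let sigma0 : sigma 0%N = 0.
Proof. by rewrite /sigma !fcoefB fcoefCM todd_fps0 fcoef1 mulr0 subrr subr0. Qed.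

(** The triangle inequality turns [todd_riccati_coef] into the hypothesis of [riccati_majorant]. *)
Let sigma_riccati n : n.+1%:R * normc (sigma n) <=
  (n == 2)%:R / 4 + \sum_(i < n.+1) normc (sigma i) * normc (sigma (n - i)%N).
Proof.
rewrite -lecR.
have -> : (n.+1%:R * normc (sigma n))%:C = `|n.+1%:R * sigma n|.
  by rewrite normrM normr_nat normcE rmorphM rmorph_nat.
rewrite todd_riccati_coef expr2 fcoefM -/sigma.
apply: le_trans (ler_normB _ _) _.
rewrite rmorphD; apply: lerD.
  by rewrite rmorphM fmorphV !rmorph_nat normrM normfV !normr_nat.
rewrite rmorph_sum; apply: le_trans (ler_norm_sum _ _ _) _.
by apply: ler_sum => i _; rewrite normrM rmorphM.
Qed.

Lemma todd_summable h : `|h| < twopi R -> summable (fun n => tau n * h ^+ n).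
Proof.
rewrite normcE /twopi ltcR => h2.
(* The midpoint lies strictly between 0 and [2 pi] even for [h = 0], which makes [sin (x / 2)]
   positive. *)
pose x := (normc h + 2 * pi) / 2.
have hx : normc h <= x by rewrite /x; move: h2; lra.
have x2 : x < 2 * pi by rewrite /x; move: h2; lra.
have x0 : 0 < x by have := normc_ge0 h; have := pi_gt0 R; rewrite /x; lra.
have sx0 : 0 < sin (x / 2).
  by apply: sin_gt0_pi; apply/andP; split; move: x0 x2; lra.
have ss : summable (fun n => sigma n * h ^+ n).
  exists ((sin (x / 2) - x / 2 * cos (x / 2)) / sin (x / 2))%:C => N.
  have := @riccati_majorant R (fun n => normc (sigma n)) (fun n => normc_ge0 _) _
    sigma_riccati N x.
  rewrite sigma0 normc0 ltW //= ltW // -ler_pdivlMr // => /(_ erefl erefl).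
  rewrite -lecR; apply: le_trans; rewrite rmorph_sum; apply: ler_sum => n _.
  rewrite normrM normrX rmorphM rmorphXn !normcE; apply: ler_wpM2l.
    by rewrite lecR normc_ge0.
  by rewrite lerXn2r // ?nnegrE ?lecR ?normc_ge0 // ltW.
have [s1 _] : fps_eval (1 + fconst 2^-1 * ft C) h (1 + 2^-1 * h).
  apply: fps_evalD; first exact: (fps_eval_const 1).
  by apply: fps_eval_mul; [exact: fps_eval_const | exact: fps_eval_t].
have := summableD s1 ss; rewrite /summable => -[B sB]; exists B => N.
apply: le_trans (sB N); apply: ler_sum => n _.
have {1}-> : tau = 1 + fconst 2^-1 * ft C + sigma by rewrite /sigma; ring.
by rewrite fcoefD mulrDl.
Qed.

(** Summable by comparison with the exponential series; the value comes from the exponential partial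
    sums with one more term, minus the constant term and divided by [-h]. *)
Lemma fexpm1_div_eval h : h != 0 ->
  fps_eval (fexpm1_div (-1)) h ((1 - cexp (- h)) / h).
Proof.
move=> h0; have [sE lE] := fps_eval_exp (-1) h; split.
  apply: summable_le sE => n; rewrite !normrM ler_wpM2r //= ler_wpM2l //.
  rewrite !normfV !normr_nat lef_pV2 ?posrE ?ltr0n ?fact_gt0 // ler_nat factS.
  by rewrite leq_pmull.
have pE N : (- h)^-1 * ((\sum_(n < N.+1) fexp (-1) n * h ^+ n) - 1) =
    \sum_(n < N) fexpm1_div (-1) n * h ^+ n.
  rewrite big_ord_recl /= expr0 fact0 divr1 mul1r addrC addrA addNr add0r mulr_sumr.
  apply: eq_bigr => n _; rewrite /= /bump /= add1n !exprS.
  have : (n.+1)`!%:R != 0 :> C by rewrite pnatr_eq0 -lt0n fact_gt0.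
  move: (n.+1)`!%:R ((-1) ^+ n) (h ^+ n) => u v t u0.
  by field; rewrite ?u0 ?h0.
have lS : \sum_(n < N.+1) fexp (-1) n * h ^+ n @[N --> \oo] --> cexp (-1 * h).
  by move: lE; rewrite -(cvg_shiftS (fun N => \sum_(n < N) fexp (-1) n * h ^+ n)).
have cst (k : C) : (fun _ : nat => k) @ \oo --> k by exact: cvg_cst.
have cv := ccvgM (cst (- h)^-1) (ccvgB lS (cst 1)).
have <- : (- h)^-1 * (cexp (-1 * h) - 1) = (1 - cexp (- h)) / h.
  by rewrite mulN1r; field; rewrite ?oppr_eq0.
by apply: cvgn_ext cv => N; exact: pE.
Qed.

Lemma todd_eval h : `|h| < twopi R -> fps_eval tau h (todd h).
Proof.
move=> h2; rewrite /todd; case: eqP => [->|/eqP h0].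
  by rewrite -(todd_fps0 C); exact: fps_eval0.
have [_] := fps_eval_inv (todd_fpsP C) (fexpm1_div_eval h0) (todd_summable h2).
by rewrite invfM invrK mulrC.
Qed.

Lemma sin_le_id y : 0 <= y -> sin y <= y.
Proof.
move=> y0; have [c _] := MVT_segment y0 (fun x _ => is_derive_sin x)
  (continuous_subspaceT (@continuous_sin R)).
rewrite sin0 !subr0 => ->; rewrite -[leRHS]mul1r ler_wpM2r //; exact: cos_le1.
Qed.

Lemma cos_ge_subr y : 0 <= y -> 1 - y <= cos y.
Proof.
move=> y0; have [c _] := MVT_segment y0 (fun x _ => is_derive_cos x)
  (continuous_subspaceT (@continuous_cos R)).
rewrite cos0 subr0 => /eqP; rewrite subr_eq => /eqP ->.
rewrite addrC lerD2r mulNr lerN2 -[leRHS]mul1r ler_wpM2r //; exact: sin_le1.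
Qed.

Lemma sum_geometric_le x N : 0 <= x -> x < 1 -> \sum_(n < N) x ^+ n <= (1 - x)^-1.
Proof.
move=> x0 x1; rewrite -[leRHS]mul1r ler_pdivlMr ?subr_gt0 //.
rewrite mulrC -[1 - x]opprB mulNr -subrX1 opprB lerBlDr lerDl exprn_ge0 //.
Qed.

(* If tau_n (2 pi)^n tended to 0, then todd (i x) would be o(1/(2 pi - x)) as
   x increases to 2 pi, which is incompatible with the simple pole at 2 pi i. *)
Lemma todd_coef_ncvg0 : ~ (tau n * twopi R ^+ n @[n --> \oo] --> (0 : C)).
Proof.
move=> t0; have p2 := pi_ge2 R; have p0 := pi_gt0 R.
pose b n := normc (tau n) * (2 * pi) ^+ n.
(* With the bound [1/8], the tail of the series contributes [pi/2] to the final estimate, which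
   leaves room below [2 pi]. *)
have [N0 bN0] : exists N0, forall n, (N0 <= n)%N -> b n <= 8^-1.
  have e0 : 0 < (8^-1 : R)%:C by rewrite ltcR invr_gt0.
  move/cvgrPdist_le: t0 => /(_ _ e0)[N0 _ bN]; exists N0 => n nN.
  have nt : `|twopi R| = (2 * pi)%:C by rewrite normc_real ger0_norm // ltW // mulr_gt0.
  have : `|0 - tau n * twopi R ^+ n| <= (8^-1)%:C by exact: bN.
  rewrite sub0r normrN normrM normrX nt normcE => le8.
  by rewrite -lecR /b rmorphM rmorphXn.
pose K := \sum_(n < N0) b n.
have b0 n : 0 <= b n by rewrite mulr_ge0 ?normc_ge0 // exprn_ge0 // mulr_ge0 // ltW.
have K0 : 0 <= K by exact: sumr_ge0.
(* Chosen so that [2 d (K + 1)], the contribution of the first [N0] terms and of the approximation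
   error, equals 1. *)
pose d := (2 * (K + 1))^-1.
have d0 : 0 < d by rewrite invr_gt0 mulr_gt0 // ltr_wpDl.
have d1 : d <= 2^-1.
  by rewrite lef_pV2 ?posrE // ?mulr_gt0 ?ltr_wpDl // ler_peMr // lerDr.
have dK : 2 * d * (K + 1) = 1.
  by rewrite /d; field; rewrite lt0r_neq0 // ltr_wpDl.
pose x := 2 * pi - d; pose a : C := 0 +i* x.
have x0 : 0 < x by rewrite /x; lra.
have na : normc a = x.
  by rewrite /normc /a expr0n add0r sqrtr_sqr ger0_norm // ltW.
have a2 : `|a| < twopi R by rewrite normcE na ltcR /x; lra.
have a0 : a != 0 by rewrite eq_complex /= negb_and (gt_eqF x0) orbT.
(* [todd a] is replaced by a partial sum with error at most 1. The head of this sum is bounded by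
   [K], the rest by [1/8] of a geometric series of ratio [x / (2 pi)], whose sum is [2 pi / d]. *)
have [_ /cvgrPdist_le /(_ 1 ltr01) [N _ /(_ N (leqnn N)) /= tN]] := todd_eval a2.
have bt : normc (todd a) <= 1 + (K + 8^-1 * (2 * pi / d)).
  rewrite -lecR rmorphD rmorph1 -normcE.
  rewrite -[X in `|X|](subrK (\sum_(n < N) tau n * a ^+ n)).
  apply: le_trans (ler_normD _ _) _; apply: lerD => //.
  apply: le_trans (ler_norm_sum _ _ _) _.
  rewrite (eq_bigr (fun n : 'I_N => (normc (tau n) * x ^+ n)%:C)); last first.
    by move=> n _; rewrite normrM normrX !normcE na rmorphM rmorphXn.
  rewrite -rmorph_sum lecR.
  apply: (@le_trans _ _ (\sum_(n < N) ((if (n < N0)%N then b n else 0) + 8^-1 * (x / (2 * pi)) ^+ n))).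
    apply: ler_sum => n _; have -> : normc (tau n) * x ^+ n = b n * (x / (2 * pi)) ^+ n.
      by rewrite /b -mulrA -exprMn mulrC [2 * pi * _]mulrC divfK 1?mulrC // gt_eqF // mulr_gt0.
    have q0 : 0 <= x / (2 * pi) by rewrite divr_ge0 ?ltW // mulr_gt0.
    have q1 : x / (2 * pi) <= 1 by rewrite ler_pdivrMr ?mul1r ?mulr_gt0 // /x; lra.
    case: ltnP => nN.
      rewrite -[leLHS]addr0 lerD ?mulr_ge0 ?exprn_ge0 //.
      by rewrite -[leRHS]mulr1 ler_wpM2l // exprn_ile1.
    by rewrite add0r ler_wpM2r ?exprn_ge0 // bN0.
  rewrite big_split /= -mulr_sumr; apply: lerD.
    rewrite -big_mkcond /= /K.
    rewrite -(big_mkord (fun n => (n < N0)%N) b) -(big_mkord xpredT b).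
    case: (leqP N0 N) => NN.
      rewrite (@big_cat_nat _ _ _ N0) //= [X in _ + X]big_nat_cond [X in _ + X]big1.
        by rewrite addr0 big_mkcond; apply: ler_sum => i _; case: ifP.
      by move=> i /andP[/andP[]]; rewrite leqNgt => /negPf ->.
    rewrite [leRHS](@big_cat_nat _ _ _ N) ?(ltnW NN) //= -[leLHS]addr0.
    apply: lerD; last exact: sumr_ge0.
    rewrite big_mkcond; apply: ler_sum => i _.
    by case: ifP.
  apply: ler_wpM2l; first by rewrite invr_ge0.
  apply: le_trans (sum_geometric_le _ _ _) _.
  - by rewrite divr_ge0 ?ltW // mulr_gt0.
  - by rewrite ltr_pdivrMr ?mul1r ?mulr_gt0 // /x; lra.
  rewrite le_eqVlt /x; apply/orP; left; apply/eqP; move: (pi : R) p0 => p p0.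
  by field; rewrite (gt_eqF d0) (gt_eqF p0).
(* Up to a multiple of [2 pi i], [-a] is [i d], so the denominator of [todd a] is of order [d]. *)
have ea : normc (1 - cexp (- a)) <= 2 * d.
  have -> : 1 - cexp (- a) = (1 - cos d)%:C - 'i * (sin d)%:C.
    rewrite /cexp /= oppr0 expR0.
    have -> : - x = d + (-1)%:~R * (2 * pi) by rewrite /x mulrN1z mulN1r opprB.
    rewrite cosD2pi_int sinD2pi_int.
    by apply/eqP; rewrite eq_complex /=; apply/andP; split; apply/eqP; ring.
  rewrite -lecR -normcE; apply: le_trans (ler_normB _ _) _.
  rewrite normrM !normc_real (_ : `|'i%C : C| = 1); last first.
    by rewrite normcE /= expr0n expr1n add0r sqrtr1.
  rewrite mul1r -rmorphD lecR; have := cos_ge_subr (ltW d0); have := sin_le_id (ltW d0).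
  rewrite !ger0_norm; first lra.
    by rewrite sin_ge0_pi // ltW //=; move: d1 p2; lra.
  by rewrite subr_ge0 cos_le1.
have e1 : 1 - cexp (- a) != 0.
  have [//] := fps_eval_inv (todd_fpsP C) (fexpm1_div_eval a0) (todd_summable a2).
  by rewrite mulf_eq0 negb_or => /andP[].
have : x <= (1 + (K + 8^-1 * (2 * pi / d))) * (2 * d).
  rewrite -na; have {1}-> : a = todd a * (1 - cexp (- a)).
    by rewrite /todd (negPf a0) divfK.
  by rewrite normcM; apply: ler_pM; rewrite ?normc_ge0.
have -> : (1 + (K + 8^-1 * (2 * pi / d))) * (2 * d) = 2 * d * (K + 1) + pi / 2.
  by move: (pi : R) => p; field; rewrite (gt_eqF d0).
(* What remains is [2 pi - d <= 1 + pi/2], impossible with [d <= 1/2] and [pi >= 2]. *)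
by rewrite dK /x; lra.
Qed.

End Todd.

(** * Local expansions *)

Section LocalTodd.
Variable R : realType.
Local Notation C := R[i].
Implicit Types (x y r : R) (z w h c q a : C).

Lemma sum_half_le N : \sum_(n < N) (2^-1 : C) ^+ n <= 2.
Proof.
suff -> : \sum_(n < N) (2^-1 : C) ^+ n = 2 - 2 * 2^-1 ^+ N.
  by rewrite lerBlDr lerDl mulr_ge0 // exprn_ge0 // invr_ge0.
elim: N => [|N IH]; first by rewrite big_ord0 expr0 mulr1 subrr.
by rewrite big_ord_recr IH /= exprS; field.
Qed.

(** The relation [f g = 1] bounds [|g_(n+1)|] by [k] times the sum of the earlier moduli, so these
    sums grow at most like [(1 + k)^n]; the smallness of [h] then compares the terms with [2^-n]. *)
Lemma finv_summable (f g : fps C) (M : C) h : f * g = 1 -> f 0%N != 0 -> 0 <= M ->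
  (forall n, `|f n.+1| <= M) -> (1 + M / `|f 0%N|) * `|h| <= 2^-1 ->
  summable (fun n => g n * h ^+ n).
Proof.
move=> fg f0 M0 fM hh; pose k := M / `|f 0%N|.
have nf0 : 0 < `|f 0%N| by rewrite normr_gt0.
have k0 : 0 <= k by rewrite divr_ge0.
have gS n : `|g n.+1| <= k * \sum_(i < n.+1) `|g i|.
  have := congr1 (fun e : fps C => e n.+1) fg.
  rewrite mulrC fcoefM fcoef1 big_ord_recr /= subnn => /eqP.
  rewrite addrC addr_eq0 => /eqP gE.
  rewrite /k mulrAC ler_pdivlMr // -normrM gE normrN.
  apply: le_trans (ler_norm_sum _ _ _) _; rewrite mulr_sumr; apply: ler_sum => i _.
  rewrite normrM mulrC ler_wpM2r // subSn ?fM //.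
  by rewrite -ltnS.
have sg n : \sum_(i < n.+1) `|g i| <= `|g 0%N| * (1 + k) ^+ n.
  elim: n => [|n IH]; first by rewrite big_ord1 expr0 mulr1.
  rewrite big_ord_recr /= exprS mulrCA.
  apply: (@le_trans _ _ ((1 + k) * \sum_(i < n.+1) `|g i|)).
    by rewrite mulrDl mul1r lerD2l; exact: gS.
  by rewrite ler_wpM2l // addr_ge0.
exists (`|g 0%N| * 2) => N.
apply: (@le_trans _ _ (\sum_(n < N) `|g 0%N| * (2^-1 : C) ^+ n)); last first.
  by rewrite -mulr_sumr ler_wpM2l // sum_half_le.
apply: ler_sum => n _; rewrite normrM normrX.
apply: (@le_trans _ _ (`|g 0%N| * (1 + k) ^+ n * `|h| ^+ n)).
  rewrite ler_wpM2r ?exprn_ge0 //; apply: le_trans (sg n).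
  by rewrite big_ord_recr /= lerDr sumr_ge0.
rewrite -mulrA -exprMn ler_wpM2l // lerXn2r // nnegrE ?invr_ge0 //.
by rewrite mulr_ge0 // addr_ge0.
Qed.

(** As a series in [h], [1 - e^-(a+h)] is [1 - q e^-h], with nonzero constant term [1 - q] and other
    coefficients of modulus at most [|q|]; [finv_summable] controls its inverse. *)
Lemma expm1_local a : cexp (- a) != 1 ->
  exists g : fps C, exists2 r, 0 < r & forall h, `|h| < r%:C ->
    1 - cexp (- (a + h)) != 0 /\ fps_eval g h (1 - cexp (- (a + h)))^-1.
Proof.
move qE: (cexp (- a)) => q qn1.
pose f : fps C := fconst 1 + fconst (- q) * fexp (-1).
have f0E : f 0%N = 1 - q by rewrite fcoefD fcoefCM /= expr0 fact0 divr1 mulr1.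
have f0 : f 0%N != 0 by rewrite f0E subr_eq0 eq_sym.
have fg : f * finv f = 1 by exact: mulfV_fps.
have fM n : `|f n.+1| <= `|q|.
  rewrite fcoefD fcoefCM /= add0r !normrM normrN normrX normrN normr1 expr1n mul1r.
  rewrite normfV normr_nat -[leRHS]mulr1 ler_wpM2l // invf_le1 ?ltr0n ?fact_gt0 //.
  by rewrite ler1n fact_gt0.
pose k : R := 1 + normc q / normc (f 0%N).
have nf0 : 0 < normc (f 0%N) by rewrite -ltcR -normcE normr_gt0.
have k1 : 0 < k by rewrite ltr_wpDr // divr_ge0 // normc_ge0.
exists (finv f), (2 * k)^-1; first by rewrite invr_gt0 mulr_gt0.
move=> h hr; have ef : fps_eval f h (1 - cexp (- (a + h))).
  rewrite opprD cexpD qE -mulNr -[- h]mulN1r; apply: fps_evalD.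
    exact: fps_eval_const.
  by apply: fps_eval_mul; [exact: fps_eval_const | exact: fps_eval_exp].
apply: (fps_eval_inv fg ef); apply: (finv_summable fg f0 (normr_ge0 q) fM).
have -> : 1 + `|q| / `|f 0%N| = k%:C.
  by rewrite !normcE /k rmorphD rmorph1 rmorphM fmorphV.
move: hr; rewrite normcE ltcR -rmorphM => hr.
have -> : (2^-1 : C) = (2^-1 : R)%:C by rewrite fmorphV rmorph_nat.
rewrite lecR mulrC -ler_pdivlMr // -invfM; exact: ltW.
Qed.

Definition analytic1_at (f : C -> C) a := exists g : fps C,
  exists2 r, 0 < r & forall h, `|h| < r%:C -> fps_eval g h (f (a + h)).

Lemma analytic1_cst c a : analytic1_at (fun=> c) a.
Proof. by exists (fconst c), 1 => // h _; exact: fps_eval_const. Qed.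

Lemma analytic1_id a : analytic1_at id a.
Proof.
exists (fconst a + ft C), 1 => // h _.
by apply: fps_evalD; [exact: fps_eval_const | exact: fps_eval_t].
Qed.

Lemma analytic1M (f g : C -> C) a : analytic1_at f a -> analytic1_at g a ->
  analytic1_at (fun z => f z * g z) a.
Proof.
move=> [u [r r0 uf]] [v [s s0 vg]]; exists (u * v), (Num.min r s).
  by rewrite lt_min r0.
move=> h; rewrite normcE ltcR lt_min => /andP[hr hs].
by apply: fps_eval_mul; [apply: uf | apply: vg]; rewrite normcE ltcR.
Qed.

Lemma analytic1D (f g : C -> C) a : analytic1_at f a -> analytic1_at g a ->
  analytic1_at (fun z => f z + g z) a.
Proof.
move=> [u [r r0 uf]] [v [s s0 vg]]; exists (u + v), (Num.min r s).
  by rewrite lt_min r0.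
move=> h; rewrite normcE ltcR lt_min => /andP[hr hs].
by apply: fps_evalD; [apply: uf | apply: vg]; rewrite normcE ltcR.
Qed.

Lemma Omega_cexp a : (forall k : int, k != 0 -> a <> k%:~R * twopii R) ->
  a != 0 -> cexp (- a) != 1.
Proof.
move=> aO a0; apply/eqP => /cexp_eq1[k ak].
apply: (aO (- k)); last by rewrite rmorphN mulNr -ak opprK.
rewrite oppr_eq0; apply: contra_neq a0 => k0.
by rewrite -[a]opprK ak k0 mul0r oppr0.
Qed.

Lemma todd_analytic1 a : (forall k : int, k != 0 -> a <> k%:~R * twopii R) ->
  analytic1_at (@todd R) a.
Proof.
move=> aO; have [->|a0] := eqVneq a 0.
  exists (todd_fps C), (2 * pi); first by rewrite mulr_gt0 // pi_gt0.
  by move=> h hr; rewrite add0r; exact: todd_eval.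
have [g [r r0 gr]] := expm1_local (Omega_cexp aO a0).
have na : 0 < normc a by rewrite -ltcR -normcE normr_gt0.
(* The radius is at most [|a|] so that [a + h] avoids 0, where [todd] takes its conventional
   value. *)
exists ((fconst a + ft C) * g), (Num.min r (normc a)); first by rewrite lt_min r0.
move=> h; rewrite normcE ltcR lt_min => /andP[hr ha].
have [_ gE] : 1 - cexp (- (a + h)) != 0 /\ fps_eval g h (1 - cexp (- (a + h)))^-1.
  by apply: gr; rewrite normcE ltcR.
rewrite /todd; case: eqP => [/eqP|_].
  rewrite addr_eq0 => /eqP e.
  have nN : normc (- h) = normc h by case: (h) => u v /=; rewrite !sqrrN.
  by exfalso; move: ha; rewrite e nN ltxx.
apply: fps_eval_mul; last exact: gE.
by apply: fps_evalD; [exact: fps_eval_const | exact: fps_eval_t].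
Qed.

End LocalTodd.

Section AnalyticTwo.
Variable R : realType.
Local Notation C := R[i].
Implicit Types (p q : C * C) (r : R).

Lemma nbhs_bidisc p (A : set (C * C)) : nbhs p A <->
  exists2 r, 0 < r & forall q, `|q.1 - p.1| < r%:C -> `|q.2 - p.2| < r%:C -> A q.
Proof.
split.
  move/nbhs_ballP => [e /= e0 eA]; have [eE e0'] := gt0_complexE e0.
  exists (complex.Re e) => // q q1 q2; apply: eA; split.
    by rewrite -ball_normE /= distrC eE.
  by rewrite -ball_normE /= distrC eE.
move=> [r r0 rA]; apply/nbhs_ballP; exists r%:C; first by rewrite /= ltcR.
move=> q [q1 q2]; apply: rA; rewrite distrC.
  by move: q1; rewrite -ball_normE.
by move: q2; rewrite -ball_normE.
Qed.

End AnalyticTwo.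

(** * Analytic maps of two variables *)

Section AnalyticMaps.
Variables (R : realType) (E : normedModType R[i]).
Local Notation C := R[i].
Implicit Types (f g : C * C -> E) (p q : C * C).

Lemma cvgnD (u v : nat -> E) (l m : E) : u @ \oo --> l -> v @ \oo --> m ->
  u n + v n @[n --> \oo] --> l + m.
Proof. exact: cvgD. Qed.

Lemma cvgnB (u v : nat -> E) (l m : E) : u @ \oo --> l -> v @ \oo --> m ->
  u n - v n @[n --> \oo] --> l - m.
Proof. exact: cvgB. Qed.

Lemma cvgnZr (u : nat -> C) (k : C) (e : E) : u @ \oo --> k ->
  u n *: e @[n --> \oo] --> k *: e.
Proof. exact: cvgZr_tmp. Qed.

Lemma analytic_at_near f g p : (\forall q \near p, f q = g q) ->
  analytic_at f p -> analytic_at g p.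
Proof.
move=> fg [c cf]; exists c; near=> q.
have -> : g q = f q by apply/esym; near: q; exact: fg.
by near: q; exact: cf.
Unshelve. all: end_near. Qed.

Lemma analytic_atD f g p : analytic_at f p -> analytic_at g p ->
  analytic_at (fun q => f q + g q) p.
Proof.
move=> [c cf] [d dg]; exists (fun j k => c j k + d j k); near=> q.
have dE j k : dbl_term (fun j k => c j k + d j k) p q j k =
    dbl_term c p q j k + dbl_term d p q j k by rewrite /dbl_term scalerDr.
have [[M cM] cl] : (exists M : C, forall N,
       \sum_(j < N) \sum_(k < N) `|dbl_term c p q j k| <= M) /\
    (\sum_(j < N) \sum_(k < N) dbl_term c p q j k @[N --> \oo] --> f q).
  by near: q; exact: cf.
have [[M' dM] dl] : (exists M : C, forall N,
       \sum_(j < N) \sum_(k < N) `|dbl_term d p q j k| <= M) /\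
    (\sum_(j < N) \sum_(k < N) dbl_term d p q j k @[N --> \oo] --> g q).
  by near: q; exact: dg.
split.
  exists (M + M') => N; apply: le_trans (lerD (cM N) (dM N)).
  rewrite -big_split; apply: ler_sum => j _; rewrite -big_split.
  by apply: ler_sum => k _; rewrite dE; exact: ler_normD.
apply: cvgn_ext (cvgD cl dl) => N; rewrite fctE -big_split; apply: eq_bigr => j _.
by rewrite -big_split; apply: eq_bigr => k _; rewrite dE.
Unshelve. all: end_near. Qed.

(** The square partial sums factor into one-variable partial sums, which gives both the bound and
    the limit. *)
Lemma analytic_at_prod (u v : C -> C) (e : E) p :
  analytic1_at u p.1 -> analytic1_at v p.2 ->
  analytic_at (fun q => (u q.1 * v q.2) *: e) p.
Proof.
move=> [f [r r0 uf]] [g [s s0 vg]]; exists (fun j k => (f j * g k) *: e).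
apply/nbhs_bidisc; exists (Num.min r s); first by rewrite lt_min r0.
move=> q; rewrite 2!normcE !ltcR !lt_min => /andP[qr _] /andP[_ qs].
have [[M fM] fl] : fps_eval f (q.1 - p.1) (u q.1).
  have e1 : p.1 + (q.1 - p.1) = q.1 by rewrite addrC subrK.
  by rewrite -{2}e1; apply: uf; rewrite normcE ltcR; exact: qr.
have [[M' gM] gl] : fps_eval g (q.2 - p.2) (v q.2).
  have e2 : p.2 + (q.2 - p.2) = q.2 by rewrite addrC subrK.
  by rewrite -{2}e2; apply: vg; rewrite normcE ltcR; exact: qs.
have dE j k : dbl_term (fun j k => (f j * g k) *: e) p q j k =
    ((f j * (q.1 - p.1) ^+ j) * (g k * (q.2 - p.2) ^+ k)) *: e.
  by rewrite /dbl_term scalerA; congr (_ *: _); ring.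
split.
  have M0 : 0 <= M by have := fM 0%N; rewrite big_ord0.
  exists (M * M' * `|e|) => N.
  apply: (@le_trans _ _ ((\sum_(j < N) `|f j * (q.1 - p.1) ^+ j|) *
      (\sum_(k < N) `|g k * (q.2 - p.2) ^+ k|) * `|e|)).
    rewrite mulr_suml mulr_suml; apply: ler_sum => j _.
    rewrite mulr_sumr mulr_suml; apply: ler_sum => k _.
    by rewrite dE normrZ normrM.
  apply: ler_wpM2r => //; apply: ler_pM; [exact: sumr_ge0|exact: sumr_ge0|exact: fM|exact: gM].
apply: cvgn_ext (cvgZr_tmp (a := e) (ccvgM fl gl)) => N.
rewrite mulr_suml scaler_suml; apply: eq_bigr => j _.
by rewrite mulr_sumr scaler_suml; apply: eq_bigr => k _; rewrite dE.
Qed.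

(* The majorant at the corner of a bidisc bounds the sum on the whole bidisc. *)
Lemma analytic_at_bounded f p : analytic_at f p ->
  exists2 r : R, 0 < r & exists M : C, forall q,
    `|q.1 - p.1| <= r%:C -> `|q.2 - p.2| <= r%:C -> `|f q| <= M.
Proof.
move=> [c /nbhs_bidisc[r r0 cr]]; pose d := r / 2.
have d0 : 0 < d by rewrite divr_gt0.
have dr : d < r by rewrite /d; lra.
have nd : `|d%:C : C| = d%:C by rewrite normc_real ger0_norm // ltW.
pose q0 := (p.1 + d%:C, p.2 + d%:C).
have e1 : q0.1 - p.1 = d%:C by rewrite /= addrAC subrr add0r.
have e2 : q0.2 - p.2 = d%:C by rewrite /= addrAC subrr add0r.
have [[M cM] _] := cr q0 ltac:(by rewrite e1 nd ltcR) ltac:(by rewrite e2 nd ltcR).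
(* The summand 1 is the error made when [f q] is replaced by a partial sum. *)
exists d => //; exists (1 + M) => q q1 q2.
have [_ lq] : (exists M : C, forall N,
       \sum_(j < N) \sum_(k < N) `|dbl_term c p q j k| <= M) /\
    (\sum_(j < N) \sum_(k < N) dbl_term c p q j k @[N --> \oo] --> f q).
  by apply: cr; [apply: le_lt_trans q1 _|apply: le_lt_trans q2 _]; rewrite ltcR.
move/cvgrPdist_le: lq => /(_ 1 ltr01)[N _ /(_ N (leqnn N)) lN].
rewrite -[X in `|X|](subrK (\sum_(j < N) \sum_(k < N) dbl_term c p q j k)).
apply: le_trans (ler_normD _ _) _; apply: lerD; first exact: lN.
apply: le_trans (cM N); apply: le_trans (ler_norm_sum _ _ _) _.
apply: ler_sum => j _; apply: le_trans (ler_norm_sum _ _ _) _.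
apply: ler_sum => k _; rewrite /dbl_term !(normrZ _ (c j k)); apply: ler_wpM2r => //.
rewrite !normrM !normrX e1 e2 nd.
have dC : 0 <= d%:C :> C by rewrite lecR ltW.
by apply: ler_pM; rewrite ?exprn_ge0 //; apply: lerXn2r; rewrite ?nnegrE.
Qed.

End AnalyticMaps.

(** * The example *)

Section BchLimit.
Variable R : realType.
Local Notation C := R[i].
Implicit Types (a b : C).

Lemma adXY a b : ad (X a) (Y b) = a *: Y b.
Proof.
apply/matrixP => i j; rewrite /ad /X /Y !mxE !big_ord_recl !big_ord0 !mxE /=.
by case: i => [[|[|]]] //= ?; case: j => [[|[|]]] //= ?; ring.
Qed.

Lemma bch_XYE a b N : bch_XY (a, b) N =
  (\sum_(n < N) todd_fps C n * a ^+ n) *: Y b + (0 < N)%N%:R *: X a.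
Proof.
transitivity (\sum_(n < N)
    ((todd_fps C n * a ^+ n) *: Y b + (n == 0%N :> nat)%:R *: X a)).
  rewrite /bch_XY /bch_partial big_add1 big_mkord; apply: eq_bigr => n _.
  exact: (bch_term_eigen (adXY a b)).
rewrite big_split -scaler_suml; congr (_ + _).
case: N => [|N]; first by rewrite big_ord0 scale0r.
by rewrite big_ord_recl /= big1 ?addr0 // => n _; rewrite scale0r.
Qed.

Lemma P_E a b : P (a, b) = todd a *: Y b + X a.
Proof.
apply/matrixP => i j; rewrite !mxE /=.
by case: i => [[|[|]]] //= ?; case: j => [[|[|]]] //= ?; rewrite ?mulr0 ?add0r ?addr0.
Qed.

Lemma cvg_head (a : 'M[C]_2) :
  ((0 < N)%N%:R : C) *: a @[N --> \oo] --> a.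
Proof.
apply: cvg_near_cst; near=> N.
have -> : (0 < N)%N by near: N; exact: nbhs_infty_gt.
by rewrite scale1r.
Unshelve. all: end_near. Qed.

Lemma bch_XY_cvg a b : `|a| < twopi R -> bch_XY (a, b) @ \oo --> P (a, b).
Proof.
move=> a2; have [_ l] := todd_eval a2; rewrite P_E.
have l2 := cvgnD (cvgnZr (e := Y b) l) (@cvg_head (X a)).
apply: (@cvgn_ext 'M[R[i]]_2 _ _ _ _ l2) => N.
by rewrite bch_XYE.
Qed.

Lemma Y0 b : b = 0 \/ b = twopii R -> Y b = 0.
Proof.
move=> b0; have -> : Y b = mx2 0 0 0 0.
  by rewrite /Y; case: b0 => ->; rewrite ?mul0r ?subrr ?mulr0.
by apply/matrixP => i j; rewrite !mxE; case: ifP => _; case: ifP.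
Qed.

Lemma bch_XY_cvg_degenerate a b : b = 0 \/ b = twopii R ->
  bch_XY (a, b) @ \oo --> X a.
Proof.
move=> b0; apply: cvgn_ext (@cvg_head (X a)) => N.
by rewrite bch_XYE Y0 // scaler0 add0r.
Qed.

(** Consecutive partial sums differ by [tau_n a^n Y b], which tends to 0 with [Y b] nonzero; if
    [|a| >= 2 pi], the terms at [2 pi] tend to 0 too, against [todd_coef_ncvg0]. *)
Lemma bch_XY_cvg_radius a b : b <> 0 -> b <> twopii R ->
  cvgn (bch_XY (a, b)) -> `|a| < twopi R.
Proof.
move=> b0 b2 cv; apply: contrapT => /negP a2.
have {}a2 : twopi R <= `|a|.
  by move: a2; rewrite normcE /twopi ltcR lecR -leNgt.
pose l := limn (bch_XY (a, b)).
have l1 : bch_XY (a, b) @ \oo --> l := cv.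
have l2 : bch_XY (a, b) n.+1 @[n --> \oo] --> l by rewrite (cvg_shiftS (bch_XY (a, b))).
have ld := cvgnB l2 l1; rewrite subrr in ld.
have Yn0 : Y b != 0.
  apply/eqP => /(congr1 (fun m : 'M[C]_2 => m 0 1)); rewrite !mxE /= => /eqP.
  by rewrite mulf_eq0 subr_eq0 => /orP[/eqP|/eqP].
have nY : 0 < `|Y b| by rewrite normr_gt0.
apply: (@todd_coef_ncvg0 R); apply/cvgrPdist_le => e e0.
have eY : 0 < e * `|Y b| by apply: mulr_gt0; [exact: e0 | exact: nY].
move/cvgrPdist_le: ld => /(_ _ eY) ld; near=> n.
have n0 : (0 < n)%N by near: n; exact: nbhs_infty_gt.
have : `|0 - (bch_XY (a, b) n.+1 - bch_XY (a, b) n)| <= e * `|Y b|.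
  by near: n; exact: ld.
have -> : bch_XY (a, b) n.+1 - bch_XY (a, b) n = (todd_fps C n * a ^+ n) *: Y b.
  have aux (A B : 'M[C]_2) (u v : C) : (u + v) *: A + B - (u *: A + B) = v *: A.
    by rewrite scalerDl opprD addrACA subrr addr0 addrAC subrr add0r.
  by rewrite !bch_XYE n0 big_ord_recr; exact: aux.
rewrite sub0r normrN normrZ => le1.
rewrite sub0r normrN -(ler_pM2r nY); apply: le_trans le1.
apply: ler_wpM2r; first exact: ltW.
rewrite !normrM !normrX; apply: ler_wpM2l; first exact: normr_ge0.
have t0 : 0 <= twopi R by rewrite /twopi lecR mulr_ge0 // pi_ge0.
by rewrite (ger0_norm t0); apply: lerXn2r; rewrite ?nnegrE.
Unshelve. all: end_near. Qed.

End BchLimit.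

(** * Topology of the domains, analyticity and singularity of the prolongation *)

Section Domains.
Variable R : realType.
Local Notation C := R[i].
Implicit Types (a b : C) (p q : C * C).

Let twopi0 : 0 < 2 * pi :> R.
Proof. by rewrite mulr_gt0 // pi_gt0. Qed.

Lemma normc_i (x : R) : `|0 +i* x : C| = `|x|%:C.
Proof. by rewrite normc_def /= expr0n add0r sqrtr_sqr. Qed.

Lemma disc_Omega a (k : int) : `|a| < twopi R -> k != 0 -> a <> k%:~R * twopii R.
Proof.
move=> a2 k0 ak; move: a2; rewrite ak int_twopiiE normc_i ltcR normrM.
rewrite (ger0_norm (ltW twopi0)) gtr_pMl // => k1.
have : `|k| < 1 by rewrite -(ltr_int R) intr_norm.
by move: k0; rewrite -normr_gt0; lia.
Qed.

(** Around a nonzero point, [expm1_local] keeps [1 - e^-z] nonzero, whereas it vanishes at the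
    excluded points; around 0 the disc of radius [2 pi] is used. *)
Lemma open_Omega : open (@Omega R).
Proof.
rewrite openE => -[a b] ab; apply/nbhs_bidisc.
have [a0|a0] := eqVneq a 0.
  exists (2 * pi) => // q q1 _ k k0; apply: disc_Omega k0.
  by move: q1; rewrite /= a0 subr0.
have [g [r r0 gr]] := expm1_local (Omega_cexp ab a0).
exists r => // q q1 _ k k0 qk; have [] := gr _ q1.
have -> : a + (q.1 - a) = q.1 by rewrite addrC subrK.
have -> : - q.1 = (- k)%:~R * twopii R by rewrite qk rmorphN mulNr.
by rewrite cexp_int_twopii subrr eqxx.
Qed.

(** For an interior point, a nearby second coordinate other than 0 and [2 pi i] still gives a point
    of [D], which forces the condition on the first coordinate. *)
Lemma interior_D : interior (@D R) = [set p | `|p.1| < twopi R].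
Proof.
apply/seteqP; split => p; last first.
  rewrite /= normcE /twopi ltcR => p2; apply/nbhs_bidisc.
  exists (2 * pi - normc p.1); first by rewrite subr_gt0.
  move=> q q1 _; have qn : `|q.1| < twopi R.
    rewrite -[q.1](subrK p.1); apply: le_lt_trans (ler_normD _ _) _.
    have e : (2 * pi)%:C - `|p.1| = (2 * pi - normc p.1)%:C by rewrite normcE rmorphB.
    by rewrite -ltrBrDr /twopi e; exact: q1.
  have [q2|q2] := pselect ([set 0; twopii R] q.2); first by right.
  by left.
move=> /nbhs_bidisc[r r0 rD]; pose t := r / 2.
have t0 : 0 < t by rewrite divr_gt0.
have tr : t < r by rewrite /t; lra.
have nt : `|t%:C : C| = t%:C by rewrite normc_real ger0_norm // ltW.
have p1 : `|p.1 - p.1| < r%:C by rewrite subrr normr0 ltcR.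
have main b : `|b - p.2| < r%:C -> b <> 0 -> b <> twopii R -> `|p.1| < twopi R.
  move=> bp b0 b2; have [[]//|[_ /=]] := rD (p.1, b) p1 bp.
  by case.
(* An exceptional second coordinate is moved by the real number [t], away from both exceptional
   values. *)
have [p0|p0] := eqVneq p.2 0.
  apply: (main t%:C); rewrite ?p0 ?subr0 ?nt ?ltcR //.
    by move=> [t00]; rewrite t00 ltxx in t0.
  by move=> [t00]; rewrite t00 ltxx in t0.
have [p2|p2] := eqVneq p.2 (twopii R).
  apply: (main (twopii R + t%:C)); rewrite ?p2 ?[_ + t%:C]addrC ?addrK ?nt ?ltcR //.
    by move=> []; rewrite addr0 => t00; rewrite t00 ltxx in t0.
  by move=> []; rewrite addr0 => t00; rewrite t00 ltxx in t0.
by apply: (main p.2); [rewrite subrr normr0 ltcR | exact/eqP | exact/eqP].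
Qed.

Lemma analytic_P p : Omega p -> analytic_at (@P R) p.
Proof.
move=> pO.
have -> : @P R = fun q => (q.1 * 1) *: mx2 (-1) 0 0 (- 2) +
    (todd q.1 * (q.2 * (q.2 - twopii R))) *: mx2 0 1 0 0.
  apply/funext => q; apply/matrixP => i j; rewrite !mxE /=.
  case: i => [[|[|]]] //= ?; case: j => [[|[|]]] //= ?; ring.
apply: analytic_atD.
  apply: (@analytic_at_prod R _ id (fun=> 1)); first exact: analytic1_id.
  exact: analytic1_cst.
apply: (@analytic_at_prod R _ (@todd R) (fun z => z * (z - twopii R))).
  exact: todd_analytic1.
apply: analytic1M; first exact: analytic1_id.
by apply: analytic1D; [exact: analytic1_id | exact: analytic1_cst].
Qed.

Lemma Omega_shift (e : R) b : e != 0 -> Omega (twopii R + e%:C, b).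
Proof.
move=> e0 k _ /= /(congr1 (@complex.Re R)); rewrite int_twopiiE /= add0r => ee.
by rewrite ee eqxx in e0.
Qed.

Lemma twopii_notin_Omega b : ~ Omega (twopii R, b).
Proof. by move=> /(_ 1 isT); rewrite mul1r. Qed.

(** In the real direction the numerator has modulus at least [2 pi], and the denominator
    [1 - expR (- e)] is at most [e]. *)
Lemma todd_pole (e : R) : 0 < e -> (2 * pi / e)%:C <= `|todd (twopii R + e%:C)|.
Proof.
move=> e0; rewrite /todd; case: eqP => [/(congr1 (@complex.Re R)) /=|_].
  by rewrite add0r => ee; rewrite ee ltxx in e0.
have -> : cexp (- (twopii R + e%:C)) = (expR (- e))%:C.
  have -> : - (twopii R + e%:C) = (-1)%:~R * twopii R + (- e)%:C.
    by rewrite opprD mulN1r rmorphN.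
  by rewrite cexpD cexp_int_twopii mul1r /cexp /= cos0 sin0 mulr1.
have ex : 0 < 1 - expR (- e) <= e.
  rewrite subr_gt0 expR_lt1 oppr_lt0 e0 /=.
  by have := expR_ge1Dx (- e); lra.
have -> : 1 - (expR (- e))%:C = (1 - expR (- e))%:C by rewrite rmorphB.
have /andP[ex0 _] := ex; rewrite normrM normfV (normc_real (1 - _)) (ger0_norm (ltW ex0)).
have n2 : (2 * pi)%:C <= `|twopii R + e%:C|.
  rewrite normc_def lecR /= add0r addr0 -[leLHS]ger0_norm ?(ltW twopi0) //.
  by rewrite -sqrtr_sqr ler_wsqrtr // lerDr sqr_ge0.
apply: (@le_trans _ _ ((2 * pi)%:C * (1 - expR (- e))^-1%:C)).
  rewrite -rmorphM lecR ler_wpM2l ?(ltW twopi0) //.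
  by case/andP: ex => ? ?; rewrite lef_pV2.
by rewrite fmorphV ler_wpM2r // invr_ge0 lecR; case/andP: ex => /ltW.
Qed.

(** An extension would be bounded by [analytic_at_bounded]. With the second coordinate fixed at
    [2 pi i + d], the factor multiplying [todd] is a nonzero constant, so [P] blows up as the first
    coordinate tends to [2 pi i]. *)
Lemma singular_P : singular_at (@Omega R) (@P R) (twopii R, twopii R).
Proof.
move=> [V [g [[Vo Vp] gA gP]]].
set p := (twopii R, twopii R) in Vp gA gP *.
have [r r0 [M gM]] := analytic_at_bounded (gA p Vp).
have [s s0 sV] := (nbhs_bidisc p V).1 (open_nbhs_nbhs (conj Vo Vp)).
(* The first two bounds keep the test points where [g] is bounded and equals [P]; [d <= 1] bounds
   their first coordinate. *)
pose d := Num.min (Num.min r (s / 2)) 1.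
have d0 : 0 < d by rewrite !lt_min r0 divr_gt0 //=.
have d1 : d <= 1 by rewrite ge_min lexx orbT.
have dr : d <= r by rewrite !ge_min lexx.
have ds : d < s.
  have : d <= s / 2 by rewrite !ge_min lexx orbT.
  by lra.
pose e12 : 'M[C]_2 := mx2 0 1 0 0; pose dg : 'M[C]_2 := mx2 (-1) 0 0 (- 2).
have n12 : 0 < `|e12|.
  rewrite normr_gt0; apply/eqP => /(congr1 (fun m : 'M[C]_2 => m 0 1)).
  by rewrite !mxE /= => /eqP; rewrite oner_eq0.
(* Bound for the upper right entry, obtained from [P q] by removing its diagonal part [q.1 *: dg],
   where [|q.1| <= 2 pi + 1]. *)
pose B : C := (M + (2 * pi + 1)%:C * `|dg|) / `|e12|.
have key (e : R) : 0 < e -> e <= d -> (d / e)%:C <= B.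
  move=> e0 ed; pose q := (twopii R + e%:C, twopii R + d%:C).
  have nn (x : R) : 0 < x -> `|twopii R + x%:C - twopii R| = x%:C.
    by move=> x0; rewrite addrAC subrr add0r normc_real ger0_norm // ltW.
  have gq : `|P q| <= M.
    rewrite -gP; last by apply: Omega_shift; rewrite gt_eqF.
      by apply: gM; rewrite nn // lecR // (le_trans ed).
    by apply: sV; rewrite nn // ltcR // (le_lt_trans ed).
  have PE : P q = (todd q.1 * (q.2 * (q.2 - twopii R))) *: e12 + q.1 *: dg.
    apply/matrixP => i j; rewrite !mxE /=.
    by case: i => [[|[|]]] //= ?; case: j => [[|[|]]] //= ?; ring.
  have q1 : `|q.1| <= (2 * pi + 1)%:C.
    apply: le_trans (ler_normD _ _) _.
    rewrite /twopii normc_i normc_real -rmorphD lecR !ger0_norm ?(ltW twopi0) ?(ltW e0) //.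
    by rewrite lerD2l (le_trans ed).
  rewrite /B ler_pdivlMr //.
  apply: (@le_trans _ _ `|(todd q.1 * (q.2 * (q.2 - twopii R))) *: e12|); last first.
    rewrite -[X in `|X|](addrK (q.1 *: dg)) -PE; apply: le_trans (ler_normB _ _) _.
    by apply: lerD => //; rewrite normrZ ler_wpM2r.
  rewrite normrZ ler_wpM2r // normrM normrM nn //.
  have t1 : (e^-1)%:C <= `|todd q.1|.
    apply: le_trans (todd_pole e0); rewrite lecR ler_peMl ?invr_ge0 ?(ltW e0) //.
    by have := pi_ge2 R; lra.
  have q2 : 1 <= `|q.2|.
    rewrite normc_def /= add0r addr0 (_ : 1 = (Num.sqrt (1 : R))%:C) ?sqrtr1 // lecR -[leLHS]sqrtr1 ler_wsqrtr //.
    by have := pi_ge2 R; have := sqr_ge0 d; nra.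
  have dC0 : 0 <= d%:C :> C by rewrite lecR ltW.
  have -> : (d / e)%:C = (e^-1)%:C * (1 * d%:C) by rewrite mul1r -rmorphM mulrC.
  have eC0 : 0 <= (e^-1)%:C :> C by rewrite lecR invr_ge0 ltW.
  by apply: ler_pM => //; [rewrite mul1r | exact: ler_wpM2r].
(* The case [e = d] gives [1 <= B], so [B] is a positive real. *)
have := key d d0 (lexx d); rewrite divff ?gt_eqF // => B1.
have [BE B0] := gt0_complexE (lt_le_trans (ltr01 : 0 < 1%:C :> C) B1).
set m := complex.Re B in BE B0.
(* The choice [e = d / (B + 1)] turns the bound into [B + 1 <= B]. *)
have := key (d / (m + 1)); rewrite invfM invrK mulrA divff ?gt_eqF // mul1r BE lecR.
rewrite divr_gt0 // ?addr_gt0 // ler_pdivrMr ?addr_gt0 // ler_peMr ?(ltW d0) ?lerDr ?(ltW B0) // => /(_ isT isT).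
by rewrite gerDl ler10.
Qed.

End Domains.

Theorem mainTheorem3 (R : realType) :
  (forall a b : R[i], cvgn (bch_XY (a, b)) <-> D (a, b)) /\
  (forall a b : R[i], `|a| < twopi R -> b <> 0 -> b <> twopii R ->
     Z (a, b) = mx2 (- a) (todd a * (b * (b - twopii R))) 0 (- (2 * a))) /\
  (forall a b : R[i], b = 0 \/ b = twopii R ->
     Z (a, b) = mx2 (- a) 0 0 (- (2 * a))) /\
  interior (@D R) = [set p : R[i] * R[i] | `|p.1| < twopi R] /\
  analytic_on (interior (@D R)) (@Z R) /\
  open (@Omega R) /\
  interior (@D R) `<=` @Omega R /\
  (forall p : R[i] * R[i], interior (@D R) p -> P p = Z p) /\
  analytic_on (@Omega R) (@P R) /\
  (closure (@Omega R) `\` interior (@Omega R)) (twopii R, twopii R) /\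
  singular_at (@Omega R) (@P R) (twopii R, twopii R) /\
  D (twopii R, twopii R) /\
  (bch_XY (twopii R, twopii R) @ \oo --> X (twopii R)).
Proof.
have limE (u : nat -> 'M[R[i]]_2) l : u @ \oo --> l -> limn u = l.
  exact: (@cvg_lim _ (@norm_hausdorff _ 'M[R[i]]_2)).
have ZP a b : `|a| < twopi R -> Z (a, b) = P (a, b).
  by move=> a2; apply: limE; exact: bch_XY_cvg.
have intO : interior (@D R) `<=` @Omega R.
  by rewrite interior_D => p p2 k k0; exact: disc_Omega.
have PZ p : interior (@D R) p -> P p = Z p.
  by rewrite interior_D; case: p => a b /= a2; rewrite ZP.
split.
  move=> a b; split=> [cv|].
    have [b0|b0] := pselect (b = 0 \/ b = twopii R); first by right.
    have [b1 b2] : b <> 0 /\ b <> twopii R by split=> e; apply: b0; [left|right].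
    by left; split => //=; exact: bch_XY_cvg_radius cv.
  move=> [[/= a2 _]|[_ /= b0]].
    by apply/cvg_ex; exists (P (a, b)); exact: bch_XY_cvg.
  by apply/cvg_ex; exists (X a); exact: bch_XY_cvg_degenerate.
split; first by move=> a b a2 _ _; exact: ZP.
split; first by move=> a b b0; apply: limE; exact: bch_XY_cvg_degenerate.
split; first exact: interior_D.
split.
  (* Analyticity is local, and [Z] agrees with [P] on an open set. *)
  move=> p pD; apply: (@analytic_at_near _ _ (@P R)); last exact/analytic_P/intO.
  have : nbhs p (interior (@D R)) by apply: open_nbhs_nbhs; split; [exact: open_interior | exact: pD].
  by apply: filterS => q; exact: PZ.
split; first exact: open_Omega.
split; first exact: intO.
split; first exact: PZ.
split; first exact: analytic_P.
split.
  split; last by move=> /interior_subset; exact: twopii_notin_Omega.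
  move=> U /nbhs_bidisc[r r0 rU]; pose e := r / 2.
  have e0 : 0 < e by rewrite divr_gt0.
  exists (twopii R + e%:C, twopii R); split.
    by apply: Omega_shift; rewrite gt_eqF.
  apply: rU; last by rewrite subrr normr0 ltcR.
  rewrite /= addrAC subrr add0r normc_real ltcR ger0_norm ?ltW //.
  by rewrite /e; lra.
split; first exact: singular_P.
split; first by right; split=> //=; right.
by apply: bch_XY_cvg_degenerate; right.
Qed.
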